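(* Let $K, L \subset \mathbb{R}^n$ be centrally symmetric convex bodies, and suppose that $K$ satisfies Mahler's inequality $$|K|\,|K^\circ| \ge \frac{4^n}{n!}.$$ Then for every symplectic capacity $c$, the Lagrangian product $K \times L \subset (\mathbb{R}^{2n},\omega_0)$ satisfies $$\frac{c(K\times L)}{c(B^{2n})} \le \left(\frac{\mathrm{vol}(K\times L)}{\mathrm{vol}(B^{2n})}\right)^{1/n},$$ equivalently $c(K\times L)^n \le n!\,\mathrm{vol}(K\times L)$.
   Context: A convex body in $\mathbb{R}^n$ is a compact convex set with nonempty interior; it is centrally symmetric if $K=-K$. $|\cdot|$ is $n$-dimensional Lebesgue measure and $K^\circ := \{y \in \mathbb{R}^n : y\cdot x \le 1 \text{ for all } x\in K\}$. $\mathbb{R}^{2n} = \mathbb{R}^n_x \times \mathbb{R}^n_y$ carries the standard symplectic form $\omega_0 = \sum_{i=1}^n dx_i\wedge dy_i$; the Lagrangian product $K\times L$ is the set of $(x,y)$ with $x\in K\subset\mathbb{R}^n_x$, $y\in L\subset\mathbb{R}^n_y$. $\mathrm{vol}$ is the symplectic volume, normalized as Lebesgue measure on $\mathbb{R}^{2n}$, so $\mathrm{vol}(B^{2n})=\pi^n/n!$, where $B^{2n}$ is the open unit ball. A symplectic capacity $c$ assigns to each $2n$-dimensional symplectic manifold $(M,\omega)$ an element of $[0,\infty]$ such that: (i) if there is a symplectic embedding of $(M,\omega)$ into $(N,\tau)$ (both of dimension $2n$), then $c(M,\omega)\le c(N,\tau)$; (ii) $c(M,\alpha\omega)=|\alpha|\,c(M,\omega)$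 for all $\alpha\in\mathbb{R}\setminus\{0\}$; (iii) $c(B^{2n},\omega_0)=c(Z^{2n},\omega_0)=\pi$, where $Z^{2n}=B^2\times\mathbb{R}^{2n-2}$ is the symplectic cylinder, with $B^2$ the open unit disc in the $(x_1,y_1)$-plane. For a domain $\Sigma\subset\mathbb{R}^{2n}$ one writes $c(\Sigma):=c(\Sigma,\omega_0)$; for a convex body $\Sigma$, $c(\Sigma)$ means the capacity of its interior. *)

(* Defs.v *)
From HB Require Import structures.
From mathcomp Require Import all_boot all_order all_algebra.
From mathcomp Require Import all_classical all_reals all_analysis.

Set Implicit Arguments.
Unset Strict Implicit.
Unset Printing Implicit Defensive.
Import Order.TTheory GRing.Theory Num.Theory.
Import numFieldNormedType.Exports.
Local Open Scope classical_set_scope.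
Local Open Scope ring_scope.

Definition convex_body (R : realType) (n : nat) (K : set 'rV[R]_n) : Prop :=
  [/\ compact K, convex_set (K : set (convex_lmodType 'rV[R]_n)) & K° !=set0].

Definition centrally_symmetric (R : realType) (n : nat) (K : set 'rV[R]_n) :
  Prop := -%R @` K = K.

Definition polar (R : realType) (n : nat) (K : set 'rV[R]_n) : set 'rV[R]_n :=
  [set y | forall x, K x -> \sum_i y 0 i * x 0 i <= 1].

(* R^2n is represented by the type of row vectors (x | y) with x, y : 'rV_n. *)
Definition lagrangian_product (R : realType) (n : nat) (K L : set 'rV[R]_n) :
  set 'rV[R]_(n + n) := [set z | K (lsubmx z) /\ L (rsubmx z)].

(* The norm of 'rV[R]_n in the library is the sup norm. *)
Definition euclidean_ball (R : realType) (n : nat) : set 'rV[R]_n :=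
  [set z | \sum_i z 0 i ^+ 2 < 1].

(* For 0 < n, the only index concerned is 0. *)
Definition symplectic_cylinder (R : realType) (n : nat) :
  set 'rV[R]_(n + n) :=
  [set z | forall i : 'I_n, i = 0%N :> nat ->
     z 0 (lshift n i) ^+ 2 + z 0 (rshift n i) ^+ 2 < 1].

Definition tuple_cons (R : realType) (n : nat)
    (p : measurableTypeR R * n.-tuple (measurableTypeR R)) :
  n.+1.-tuple (measurableTypeR R) := [tuple of p.1 :: p.2].

Lemma measurable_tuple_cons (R : realType) (n : nat) :
  measurable_fun [set: _] (@tuple_cons R n).
Proof. exact: measurable_cons. Qed.

Section lebesgue_cons.
Context (R : realType) (n : nat).
Variable mu : {measure set (n.-tuple (measurableTypeR R)) -> \bar R}.

Definition lebesgue_cons : set (n.+1.-tuple (measurableTypeR R)) -> \bar R :=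
  pushforward (@lebesgue_measure R \x^ mu)%E (@tuple_cons R n).

Let lebesgue_cons_measure : {measure set _ -> \bar R} :=
  measure_function_pushforward__canonical__measure_function_Measure
    (@lebesgue_measure R \x^ mu)%E (@measurable_tuple_cons R n).

HB.instance Definition _ := isMeasure.Build _ _ _ lebesgue_cons
  (measure0 lebesgue_cons_measure) (measure_ge0 lebesgue_cons_measure)
  (@measure_semi_sigma_additive _ _ _ lebesgue_cons_measure).

End lebesgue_cons.

(* The n-fold product of the one-dimensional Lebesgue measure, on the product
   sigma-algebra of n-tuples (the Borel sets of R^n). *)
Fixpoint lebesgue_tuple (R : realType) (n : nat) :
    {measure set (n.-tuple (measurableTypeR R)) -> \bar R} :=
  match n with
  | 0 => \d_ [tuple]
  | m.+1 => lebesgue_cons (lebesgue_tuple R m)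
  end.

Definition volume (R : realType) (n : nat) (A : set 'rV[R]_n) : \bar R :=
  lebesgue_tuple R n [set t | A (\row_i tnth t i)].

(* All the iterated partial derivatives of order at most k exist and are
   continuous on U, which is meant to be open. *)
Fixpoint Ck_on (R : realType) (m : nat) (V : normedModType R) (k : nat)
    (U : set 'rV[R]_m) (f : 'rV[R]_m -> V) : Prop :=
  (forall x, U x -> {for x, continuous f}) /\
  match k with
  | 0 => True
  | j.+1 => forall i : 'I_m,
      (forall x, U x -> derivable f x (delta_mx 0 i)) /\
      Ck_on j U ('D_(delta_mx 0 i) f)
  end.

Definition smooth_on (R : realType) (m : nat) (V : normedModType R)
    (U : set 'rV[R]_m) (f : 'rV[R]_m -> V) : Prop :=
  forall k, Ck_on k U f.

(* chart_map is only meaningful on chart_dom. *)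
Record chart (R : realType) (m : nat) (T : topologicalType) := Chart {
  chart_dom : set T;
  chart_map :> T -> 'rV[R]_m }.

Definition chart_image (R : realType) (m : nat) (T : topologicalType)
    (phi : chart R m T) : set 'rV[R]_m := phi @` chart_dom phi.

(* A homeomorphism from an open set onto an open subset of R^m. *)
Definition is_chart (R : realType) (m : nat) (T : topologicalType)
    (phi : chart R m T) : Prop :=
  [/\ open (chart_dom phi),
      {in chart_dom phi &, injective phi},
      (forall p, chart_dom phi p -> {for p, continuous phi}) &
      (forall W, open W -> W `<=` chart_dom phi -> open (phi @` W))].

(* g represents f in the charts phi and psi, that is g = psi o f o phi^-1 on
   chart_overlap phi psi f; its values elsewhere are irrelevant. *)
Definition local_rep (R : realType) (m : nat) (S T : topologicalType)
    (phi : chart R m S) (psi : chart R m T) (f : S -> T)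
    (g : 'rV[R]_m -> 'rV[R]_m) : Prop :=
  forall p, chart_dom phi p -> chart_dom psi (f p) -> g (phi p) = psi (f p).

Definition chart_overlap (R : realType) (m : nat) (S T : topologicalType)
    (phi : chart R m S) (psi : chart R m T) (f : S -> T) : set 'rV[R]_m :=
  phi @` (chart_dom phi `&` f @^-1` chart_dom psi).

Definition smooth_in_charts (R : realType) (m : nat) (S T : topologicalType)
    (phi : chart R m S) (psi : chart R m T) (f : S -> T) : Prop :=
  exists2 g, local_rep phi psi f g & smooth_on (chart_overlap phi psi f) g.

Record smooth_manifold (R : realType) (m : nat) := SmoothManifold {
  mfd_space :> topologicalType;
  atlas : set (chart R m mfd_space);
  mfd_hausdorff : hausdorff_space mfd_space;
  mfd_second_countable : @second_countable mfd_space;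
  atlas_chart : forall phi, atlas phi -> is_chart phi;
  atlas_cover : forall p, exists2 phi, atlas phi & chart_dom phi p;
  atlas_smooth : forall phi psi, atlas phi -> atlas psi ->
    smooth_in_charts phi psi id }.

Definition smooth_map (R : realType) (m : nat) (M N : smooth_manifold R m)
    (f : M -> N) : Prop :=
  continuous f /\
  forall phi psi, atlas phi -> atlas psi -> smooth_in_charts phi psi f.

(* A 2-form on a subset of R^m is given by its matrix W, with
   omega_x(u, v) = u *m W x *m v^T on row vectors; as the library's Jacobian
   also acts on row vectors, 'd g x u = u *m jacobian g x. *)
Definition pullback (R : realType) (m : nat) (g : 'rV[R]_m -> 'rV[R]_m)
    (W : 'rV[R]_m -> 'M[R]_m) (x : 'rV[R]_m) : 'M[R]_m :=
  jacobian g x *m W (g x) *m (jacobian g x)^T.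

Definition closed_form_at (R : realType) (m : nat) (W : 'rV[R]_m -> 'M[R]_m)
    (x : 'rV[R]_m) : Prop :=
  forall i j k : 'I_m,
    'D_(delta_mx 0 i) (fun y => W y j k) x +
    'D_(delta_mx 0 j) (fun y => W y k i) x +
    'D_(delta_mx 0 k) (fun y => W y i j) x = 0.

(* The family of the coordinate expressions of a symplectic form; the values
   outside the atlas, or outside the images of the charts, are irrelevant. *)
Record symplectic_form (R : realType) (m : nat) (M : smooth_manifold R m) :=
  SymplecticForm {
  form_coord :> chart R m M -> 'rV[R]_m -> 'M[R]_m;
  form_smooth : forall phi, atlas phi ->
    smooth_on (chart_image phi) (form_coord phi);
  form_transition : forall phi psi tau, atlas phi -> atlas psi ->
    local_rep phi psi id tau ->
    forall p, chart_dom phi p -> chart_dom psi p ->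
      form_coord phi (phi p) = pullback tau (form_coord psi) (phi p);
  form_alternating : forall phi x, atlas phi -> chart_image phi x ->
    (form_coord phi x)^T = - form_coord phi x;
  form_nondegenerate : forall phi x, atlas phi -> chart_image phi x ->
    form_coord phi x \in unitmx;
  form_closed : forall phi x, atlas phi -> chart_image phi x ->
    closed_form_at (form_coord phi) x }.

(* The immersion condition is implied by f^* tau = omega, since omega is
   nondegenerate. *)
Definition symplectic_embedding (R : realType) (m : nat)
    (M : smooth_manifold R m) (omega : symplectic_form M)
    (N : smooth_manifold R m) (tau : symplectic_form N) (f : M -> N) : Prop :=
  [/\ smooth_map f,
      injective f,
      (forall U : set M, open U ->
         exists2 V : set N, open V & f @` U = V `&` range f) &
      (forall phi psi g, atlas phi -> atlas psi -> local_rep phi psi f g ->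
         forall p, chart_dom phi p -> chart_dom psi (f p) ->
           omega phi (phi p) = pullback g (tau psi) (phi p))].

(* The interior of S, with the inclusion into R^m as its only chart; for an
   open S this is S itself. *)
Definition domain_chart (R : realType) (m : nat) (S : set 'rV[R]_m) :
  chart R m (set_type S°) := Chart setT (@set_val _ S°).

Lemma domain_hausdorff (R : realType) (m : nat) (S : set 'rV[R]_m) :
  hausdorff_space (set_type S°).
Proof.
rewrite open_hausdorff => p q pq.
have vpq : set_val p != set_val q by apply: contra pq => /eqP/val_inj ->.
have := @norm_hausdorff R 'rV[R]_m; rewrite open_hausdorff.
move=> /(_ _ _ vpq)[[A B] [pA qB] [oA oB AB0]].
exists (set_val @^-1` A, set_val @^-1` B).
  by split; rewrite inE /=; [move: pA|move: qB]; rewrite inE.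
split; [by exists A|by exists B|].
by move/eqP: AB0 => AB0; rewrite -preimage_setI AB0 preimage_set0.
Qed.

Lemma domain_second_countable (R : realType) (m : nat) (S : set 'rV[R]_m) :
  @second_countable (set_type S°).
Proof.
pose B (qk : 'rV[rat]_m * nat) : set 'rV[R]_m :=
  ball (map_mx (ratr : rat -> R) qk.1) qk.2.+1%:R^-1.
exists (range (fun qk => set_val @^-1` B qk : set (set_type S°))).
  exact: sub_countable (card_image_le _ _) (countableP _).
split; first by move=> _ [qk _ <-]; exists (B qk) => //; exact: ball_open.
move=> p U; rewrite nbhsE => -[_ [[A oA <-] Ap] AU].
have /nbhs_ballP[e /= e0 eA] : nbhs (set_val p) A by exact: open_nbhs_nbhs.
have [k] : exists k, k.+1%:R^-1 < e / 2.
  have e20 : 0 < e / 2 by rewrite divr_gt0.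
  have [k _ ke] := near_infty_natSinv_lt (PosNum e20).
  by exists k; exact: (ke k (leqnn k)).
move=> ke; have k0 : 0 < k.+1%:R^-1 :> R by rewrite invr_gt0.
have qP i : exists q : rat, `|ratr q - set_val p 0 i| < k.+1%:R^-1.
  have /rat_in_itvoo[q] : set_val p 0 i - k.+1%:R^-1 < set_val p 0 i.
    by rewrite ltrBlDr ltrDl.
  rewrite in_itv /= => /andP[q1 q2]; exists q.
  by rewrite distrC gtr0_norm ?subr_gt0 // ltrBlDr -ltrBlDl.
pose q := \row_i xchoose (qP i) : 'rV[rat]_m.
have pq : ball (map_mx (ratr : rat -> R) q) k.+1%:R^-1 (set_val p).
  split => // i j; rewrite (ord1 i) !mxE /ball /=.
  exact: (xchooseP (qP j)).
exists (set_val @^-1` B (q, k)); first by split => //; exists (q, k).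
move=> y yq; apply: AU; apply: eA => /=.
apply: (@le_ball _ _ _ (k.+1%:R^-1 + k.+1%:R^-1)).
  by rewrite [e in leRHS]splitr lerD // ltW.
exact: ball_triangle (ball_sym pq) yq.
Qed.

Lemma domain_is_chart (R : realType) (m : nat) (S : set 'rV[R]_m) phi :
  [set domain_chart S] phi -> is_chart phi.
Proof.
move=> ->; split.
- exact: openT.
- by move=> p q _ _ /val_inj.
- by move=> p _; exact: (@initial_continuous _ _ (@set_val _ S°) p).
- move=> _ [A oA <-] _; rewrite (_ : _ @` _ = A `&` S°).
    by apply: openI => //; exact: open_interior.
  apply/seteqP; split=> [_ [p Ap <-]|x [Ax Sx]].
    by split => //; exact: set_valP.
  by exists (exist _ x (mem_set Sx)).
Qed.

Lemma domain_cover (R : realType) (m : nat) (S : set 'rV[R]_m)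
    (p : set_type S°) : exists2 phi, [set domain_chart S] phi & chart_dom phi p.
Proof. by exists (domain_chart S). Qed.

Lemma Ck_on_cst (R : realType) (m : nat) (V : normedModType R) k
    (U : set 'rV[R]_m) (a : V) : Ck_on k U (cst a).
Proof.
have cont b x : U x -> {for x, continuous (cst b : 'rV[R]_m -> V)}.
  by move=> _; exact: cst_continuous.
elim: k a => [|k IHk] a; split; [exact: cont|by []|exact: cont|].
move=> i; split=> [x _|]; first exact: derivable_cst.
rewrite (_ : 'D_(delta_mx 0 i) (cst a) = cst 0); first exact: IHk.
by apply/funext => x; rewrite derive_cst.
Qed.

Lemma Ck_on_id (R : realType) (m : nat) k (U : set 'rV[R]_m) : Ck_on k U id.
Proof.
have cont x : U x -> {for x, continuous (@id 'rV[R]_m)}.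
  by move=> _; exact: cvg_id.
case: k => [|k]; split; [exact: cont|by []|exact: cont|].
move=> i; split=> [x _|]; first exact: derivable_id.
rewrite (_ : 'D_(delta_mx 0 i) id = cst (delta_mx 0 i)); first exact: Ck_on_cst.
by apply/funext => x; rewrite derive_id.
Qed.

Lemma domain_smooth (R : realType) (m : nat) (S : set 'rV[R]_m) phi psi :
  [set domain_chart S] phi -> [set domain_chart S] psi ->
  smooth_in_charts phi psi id.
Proof.
by move=> -> ->; exists id => // k; exact: Ck_on_id.
Qed.

Definition domain (R : realType) (m : nat) (S : set 'rV[R]_m) :
    smooth_manifold R m :=
  SmoothManifold (@domain_hausdorff R m S) (@domain_second_countable R m S)
    (@domain_is_chart R m S) (@domain_cover R m S) (@domain_smooth R m S).

(* The matrix of omega_0 = \sum_i dx_i /\ dy_i. *)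
Definition standard_form_mx (R : realType) (n : nat) : 'M[R]_(n + n) :=
  block_mx 0 1%:M (- 1%:M) 0.

Definition domain_coord (R : realType) (n : nat) (S : set 'rV[R]_(n + n))
    (phi : chart R (n + n) (domain S)) (x : 'rV[R]_(n + n)) : 'M[R]_(n + n) :=
  standard_form_mx R n.

Lemma standard_form_smooth (R : realType) (n : nat) (S : set 'rV[R]_(n + n)) :
  forall phi, @atlas _ _ (domain S) phi ->
  smooth_on (chart_image phi) (domain_coord phi).
Proof. by move=> phi _ k; exact: Ck_on_cst. Qed.

Lemma standard_form_transition (R : realType) (n : nat)
    (S : set 'rV[R]_(n + n)) (phi psi : chart R (n + n) (domain S)) tau :
  atlas phi -> atlas psi -> local_rep phi psi id tau ->
  forall p, chart_dom phi p -> chart_dom psi p ->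
  domain_coord phi (phi p) = pullback tau (domain_coord psi) (phi p).
Proof.
move=> -> -> tauE p _ _; rewrite /pullback /domain_coord /=.
have Sx : nbhs (set_val p) S° by apply: open_nbhs_nbhs; split => //;
  [exact: open_interior|exact: set_valP].
have taux y : S° y -> tau y = y.
  by move=> Sy; exact: (tauE (exist _ y (mem_set Sy)) I I).
have dtau : 'd tau (set_val p) = idfun :> ('rV[R]_(n + n) -> 'rV[R]_(n + n)).
  apply: diff_unique; first by move=> x; exact: cvg_id.
  apply/eqaddoP => e e0.
  have : \forall h \near (0 : 'rV[R]_(n + n)), S° (h + set_val p).
    have shiftp : (h + set_val p) @[h --> (0 : 'rV[R]_(n + n))] --> set_val p.
      rewrite -[X in _ --> X]add0r.
      exact: (cvgD (@cvg_id _ _) (cvg_cst _)).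
    exact: (shiftp _ Sx).
  apply: filterS => h Sh; rewrite /= !fctE /= !taux //; last exact: set_valP.
  by rewrite [h + _]addrC subrr normr0 mulr_ge0 // ltW.
have -> : jacobian tau (set_val p) = 1%:M.
  apply/row_matrixP => i; rewrite !rowE mul_rV_lin1 /= mulmx1.
  by rewrite -[RHS]/(idfun (delta_mx 0 i : 'rV[R]_(n + n))) -dtau.
by rewrite mul1mx trmx1 mulmx1.
Qed.

Lemma standard_form_alternating (R : realType) (n : nat)
    (S : set 'rV[R]_(n + n)) (phi : chart R (n + n) (domain S)) x :
  atlas phi -> chart_image phi x ->
  (domain_coord phi x)^T = - domain_coord phi x.
Proof.
by move=> _ _; rewrite /domain_coord /standard_form_mx tr_block_mx opp_block_mx
  !trmx0 linearN /= trmx1 opprK !oppr0.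
Qed.

Lemma standard_form_nondegenerate (R : realType) (n : nat)
    (S : set 'rV[R]_(n + n)) (phi : chart R (n + n) (domain S)) x :
  atlas phi -> chart_image phi x -> domain_coord phi x \in unitmx.
Proof.
move=> _ _; apply: (proj1 (@mulmx1_unit _ _ _ (- standard_form_mx R n) _)).
rewrite mulmxN /domain_coord /standard_form_mx mulmx_block.
rewrite !(mulmx0, mul0mx, mulmx1, mul1mx, addr0, add0r).
by rewrite opp_block_mx opprK oppr0 -scalar_mx_block.
Qed.

Lemma standard_form_closed (R : realType) (n : nat)
    (S : set 'rV[R]_(n + n)) (phi : chart R (n + n) (domain S)) x :
  atlas phi -> chart_image phi x -> closed_form_at (domain_coord phi) x.
Proof. by move=> _ _ i j k; rewrite !derive_cst !addr0. Qed.

Definition standard_form (R : realType) (n : nat) (S : set 'rV[R]_(n + n)) :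
    symplectic_form (domain S) :=
  SymplecticForm (@standard_form_smooth R n S)
    (@standard_form_transition R n S) (@standard_form_alternating R n S)
    (@standard_form_nondegenerate R n S) (@standard_form_closed R n S).

(* Meant for 0 < n: for n = 0 there is no unit disc, and symplectic_cylinder is
   the whole space. *)
Record symplectic_capacity (R : realType) (n : nat) := SymplecticCapacity {
  capacity_of :> forall M : smooth_manifold R (n + n),
    symplectic_form M -> \bar R;
  capacity_ge0 : forall M (omega : symplectic_form M),
    (0 <= capacity_of omega)%E;
  capacity_monotone : forall M N (omega : symplectic_form M)
    (tau : symplectic_form N) (f : M -> N),
    symplectic_embedding omega tau f ->
    (capacity_of omega <= capacity_of tau)%E;
  (* the hypothesis says that omega' = alpha * omega *)
  capacity_conformal : forall M (omega omega' : symplectic_form M) (alpha : R),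
    alpha != 0 ->
    (forall phi x, atlas phi -> chart_image phi x ->
       omega' phi x = alpha *: omega phi x) ->
    capacity_of omega' = (`|alpha|%:E * capacity_of omega)%E;
  capacity_ball :
    capacity_of (standard_form (@euclidean_ball R (n + n))) = (pi : R)%:E;
  capacity_cylinder :
    capacity_of (standard_form (@symplectic_cylinder R n)) = (pi : R)%:E }.

Definition capacity (R : realType) (n : nat) (c : symplectic_capacity R n)
  (S : set 'rV[R]_(n + n)) : \bar R := c _ (standard_form S).

(* Main.v *)
From HB Require Import structures.
From mathcomp Require Import all_boot all_order all_algebra.
From mathcomp Require Import all_classical all_reals all_analysis.
From mathcomp Require Import measurable_realfun.
From mathcomp Require Import ring lra.
Require Import Defs.
Set Implicit Arguments.
Unset Strict Implicit.
Unset Printing Implicit Defensive.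
Import Order.TTheory GRing.Theory Num.Theory.
Import numFieldNormedType.Exports.
Local Open Scope classical_set_scope.
Local Open Scope ring_scope.

(** Write <q, x> for the Euclidean pairing.  Among all q in the polar of K and
    x in the polar of L, choose a pair that maximizes <q, x>; it exists because
    both polars are compact, and its value M is positive because both contain a
    neighbourhood of 0 ([extremal_polar_pair]).  This pair controls both sides
    of the inequality.

    Upper bound for the capacity.  By the symmetry of K and L, the product
    K x L lies in the slab |<q, X>| <= 1, |<x, Y>| <= 1.  Since <q, x> = M,
    a linear map of the form (X, Y) |-> (X A, Y D) with A D^T a multiple of the
    identity sends <q, X> and <x, Y> to the conjugate coordinates X_1 and Y_1
    up to scaling, so that the interior of the slab becomes a product of an
    open rectangle in the (X_1, Y_1)-plane with R^(2n-2).  An open rectangle of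
    area pi is mapped into the open unit disc by an area-preserving
    diffeomorphism onto its image: slice the disc by vertical chords and
    reparametrize each chord linearly.  Hence the interior of the slab embeds
    in the symplectic cylinder after rescaling the form, and conformality gives
    c(K x L) <= 4 / M ([capacity_between_hyperplanes]).

    Lower bound for the volume.  If M y lies in the polar of K, then by the
    choice of (q, x) one has <y, x'> <= 1 for all x' in the polar of L, so y is
    in L by the bipolar theorem ([bipolar_sub]).  Thus M^-1 times the polar of K
    is contained in L, and Mahler's inequality for K gives
      n! vol(K x L) = n! |K| |L| >= n! M^-n |K| |polar K| >= (4 / M)^n.

    Both bounds together are the second inequality.  The first one is the same
    statement after normalization by the unit ball, whose capacity is pi and
    whose volume is pi^n / n! ([volume_euclidean_ball]). *)

(** * Smooth maps and rings of functions *)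

Lemma near_eq_diff (R : numFieldType) (V W : normedModType R) (f g : V -> W)
    (x : V) :
  (\near x, f x = g x) -> differentiable f x -> 'd g x =1 'd f x.
Proof.
move=> fg df v; congr (_ v); apply: diff_unique; first exact: diff_continuous.
have fgx : f x = g x by exact: nbhs_singleton fg.
apply/eqaddoP => e e0.
have /eqaddoP/(_ e e0) := diff_locally df.
have sx : (h + x) @[h --> (0 : V)] --> x.
  by rewrite -[X in _ --> X]add0r; exact: (cvgD (@cvg_id _ _) (cvg_cst _)).
have {}fg : \forall h \near (0 : V), f (h + x) = g (h + x) by exact: (sx _ fg).
apply: filterS2 fg => h /= fgh.
by rewrite !fctE /= fgh fgx.
Qed.

Lemma near_eq_jacobian (R : numFieldType) (m p : nat)
    (f g : 'rV[R]_m -> 'rV[R]_p) (x : 'rV[R]_m) :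
  (\near x, f x = g x) -> differentiable f x -> jacobian g x = jacobian f x.
Proof.
move=> fg df; apply/matrixP => i j; rewrite /jacobian [LHS]mxE [RHS]mxE.
have E : 'd g x (delta_mx 0 i) = 'd f x (delta_mx 0 i).
  exact: near_eq_diff fg df _.
exact: (congr1 (fun w : 'rV_p => w 0 j) E).
Qed.

Lemma differentiable_row (R : realType) (m p : nat) (f : 'rV[R]_m -> 'rV[R]_p)
    x : (forall j, differentiable (fun y => f y 0 j) x) -> differentiable f x.
Proof.
move=> df; have -> : f = \sum_(j < p) (fun y => f y 0 j *: delta_mx 0 j).
  by apply/funext => y; rewrite fct_sumE [LHS]row_sum_delta.
by apply: differentiable_sum => j; exact: differentiableZl.
Qed.

(** The smallest ring of functions that contains the constants and B.  When B
    consists of differentiable functions whose partial derivatives lie in this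
    ring, so does every iterated partial derivative of its elements; this turns
    smoothness into a statement about first derivatives of the generators. *)
Inductive generated_ring (R : realType) (m : nat)
    (B : set ('rV[R]_m -> R)) : set ('rV[R]_m -> R) :=
| generator f : B f -> generated_ring B f
| generated_cst a : generated_ring B (fun=> a)
| generated_add f g : generated_ring B f -> generated_ring B g ->
    generated_ring B (fun x => f x + g x)
| generated_mul f g : generated_ring B f -> generated_ring B g ->
    generated_ring B (fun x => f x * g x).

Section generated_smooth.
Context (R : realType) (m : nat) (U : set 'rV[R]_m) (B : set ('rV[R]_m -> R)).
Hypothesis oU : open U.
Hypothesis dB : forall b, B b -> forall x, U x -> differentiable b x.
Hypothesis derB : forall b, B b -> forall i, exists2 g, generated_ring B g &
  forall x, U x -> 'D_(delta_mx 0 i) b x = g x.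

Lemma generated_differentiable f : generated_ring B f ->
  forall x, U x -> differentiable f x.
Proof.
elim=> [b Bb|a|g h _ IHg _ IHh|g h _ IHg _ IHh] x Ux.
- exact: dB.
- exact: differentiable_cst.
- by apply: differentiableD; [exact: IHg|exact: IHh].
- by apply: differentiableM; [exact: IHg|exact: IHh].
Qed.

Lemma generated_derive f : generated_ring B f ->
  forall i, exists2 g, generated_ring B g &
    forall x, U x -> 'D_(delta_mx 0 i) f x = g x.
Proof.
elim=> [b Bb|a|g h rg IHg rh IHh|g h rg IHg rh IHh] i.
- exact: derB.
- exists (fun=> 0); first exact: generated_cst.
  by move=> x _; exact: derive_cst.
- have [g' rg' Dg] := IHg i; have [h' rh' Dh] := IHh i.
  exists (fun x => g' x + h' x); first exact: generated_add.
  move=> x Ux; have dg := generated_differentiable rg Ux.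
  have dh := generated_differentiable rh Ux.
  by rewrite -Dg// -Dh// -deriveD//; exact: diff_derivable.
- have [g' rg' Dg] := IHg i; have [h' rh' Dh] := IHh i.
  exists (fun x => g x * h' x + h x * g' x).
    by apply: generated_add; exact: generated_mul.
  move=> x Ux; have dg := generated_differentiable rg Ux.
  have dh := generated_differentiable rh Ux.
  by rewrite -Dg// -Dh// -deriveM//; exact: diff_derivable.
Qed.

(** The coordinates agree with elements of the ring on U only, since this is all
    that the induction knows about the partial derivatives of the map; as U is
    open, it determines the derivatives at the points of U. *)
Lemma generated_smooth (p : nat) (f : 'rV[R]_m -> 'rV[R]_p) :
  (forall j, exists2 g, generated_ring B g & forall x, U x -> f x 0 j = g x) ->
  smooth_on U f.
Proof.
move=> + k; elim: k f => [|k IHk] f rf.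
all: have /choice[G GP] : forall j, exists g,
    generated_ring B g /\ forall x, U x -> f x 0 j = g x by
  move=> j; have [g rg fg] := rf j; exists g.
all: pose F x := \row_j G j x : 'rV[R]_p.
all: have FU x : U x -> f x = F x by
  move=> Ux; apply/rowP => j; rewrite mxE; exact: (GP j).2.
all: have Fnear x : U x -> \near x, F x = f x by
  move=> Ux; apply: filterS (open_nbhs_nbhs (conj oU Ux)) => y Uy; rewrite FU.
all: have dF x : U x -> differentiable F x by
  move=> Ux; apply: differentiable_row => j;
  rewrite (_ : (fun y => _) = G j);
    [exact: generated_differentiable (GP j).1 _ Ux|
     apply/funext => y; rewrite mxE].
all: have cf x : U x -> {for x, continuous f} by
  move=> Ux; rewrite /prop_for /continuous_at FU//;
  apply: (cvg_trans (near_eq_cvg (Fnear x Ux)));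
  exact: differentiable_continuous (dF x Ux).
  by split.
split=> // i; split=> [x Ux|].
  by apply: near_eq_derivable (Fnear x Ux) _; exact/diff_derivable/dF.
apply: IHk => j.
have [g rg fg] := rf j; have [g' rg' Dg] := generated_derive rg i.
exists g' => // x Ux; rewrite derive_mx; last first.
  by apply: near_eq_derivable (Fnear x Ux) _; exact/diff_derivable/dF.
rewrite mxE -Dg//; apply: near_eq_derive.
by apply: filterS (open_nbhs_nbhs (conj oU Ux)) => y Uy; rewrite fg.
Qed.

End generated_smooth.

(** * Symplectic embeddings of domains *)

Section scaled_form.
Context (R : realType) (n : nat) (S : set 'rV[R]_(n + n)) (alpha : R).
Hypothesis alpha0 : alpha != 0.

Let coord (phi : chart R (n + n) (domain S)) (x : 'rV[R]_(n + n)) :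
  'M[R]_(n + n) := alpha *: standard_form_mx R n.

Lemma scaled_form_smooth phi : @atlas _ _ (domain S) phi ->
  smooth_on (chart_image phi) (coord phi).
Proof. by move=> _ k; exact: Ck_on_cst. Qed.

Lemma scaled_form_transition (phi psi : chart R (n + n) (domain S)) tau :
  atlas phi -> atlas psi -> local_rep phi psi id tau ->
  forall p, chart_dom phi p -> chart_dom psi p ->
  coord phi (phi p) = pullback tau (coord psi) (phi p).
Proof.
move=> aphi apsi tauE p phip psip; rewrite /coord /pullback.
rewrite -scalemxAr -scalemxAl; congr (_ *: _).
exact: (@standard_form_transition R n S phi psi tau).
Qed.

Lemma scaled_form_alternating (phi : chart R (n + n) (domain S)) x :
  atlas phi -> chart_image phi x -> (coord phi x)^T = - coord phi x.
Proof.
move=> aphi px; rewrite /coord linearZ/= -scalerN; congr (_ *: _).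
exact: (@standard_form_alternating R n S phi x).
Qed.

Lemma scaled_form_nondegenerate (phi : chart R (n + n) (domain S)) x :
  atlas phi -> chart_image phi x -> coord phi x \in unitmx.
Proof.
move=> aphi px; rewrite unitmxZ ?unitfE//.
exact: (@standard_form_nondegenerate R n S phi x).
Qed.

Lemma scaled_form_closed (phi : chart R (n + n) (domain S)) x :
  atlas phi -> chart_image phi x -> closed_form_at (coord phi) x.
Proof. by move=> _ _ i j k; rewrite !derive_cst !addr0. Qed.

Definition scaled_form : symplectic_form (domain S) :=
  SymplecticForm scaled_form_smooth scaled_form_transition
    scaled_form_alternating scaled_form_nondegenerate scaled_form_closed.

End scaled_form.

(** A conformal map f of factor alpha is a symplectic embedding once the form of
    the source is multiplied by alpha, whence the factor alpha by conformality.
    The left inverse h, continuous on the target, provides both injectivity and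
    the openness of f onto its image. *)
Lemma capacity_le_embedding (R : realType) (n : nat)
    (c : symplectic_capacity R n) (S S' : set 'rV[R]_(n + n))
    (f h : 'rV[R]_(n + n) -> 'rV[R]_(n + n)) (alpha : R) :
  0 < alpha ->
  (forall x, S° x -> S'° (f x)) ->
  smooth_on S° f ->
  (forall x, S° x -> differentiable f x) ->
  (forall x, S° x -> jacobian f x *m standard_form_mx R n *m (jacobian f x)^T =
     alpha *: standard_form_mx R n) ->
  (forall x, S° x -> h (f x) = x) ->
  (forall y, S'° y -> {for y, continuous h}) ->
  (alpha%:E * capacity c S <= capacity c S')%E.
Proof.
move=> alpha0 fS smf df jf hK ch.
have a0 : alpha != 0 by rewrite gt_eqF.
have -> : (alpha%:E * capacity c S = c _ (scaled_form S a0))%E.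
  rewrite (@capacity_conformal _ _ c _ (standard_form S) (scaled_form S a0)
    alpha)//.
  by rewrite gtr0_norm.
pose F (p : domain S) : domain S' :=
  exist _ (f (set_val p)) (mem_set (fS _ (set_valP p))).
have valF p : set_val (F p) = f (set_val p) by [].
apply: (@capacity_monotone _ _ c _ _ _ _ F); split.
- split.
    apply: continuous_comp_initial => p.
    apply: (@continuous_comp _ _ _ set_val f).
      exact: (@initial_continuous _ _ (@set_val _ S°) p).
    exact/differentiable_continuous/df/set_valP.
  move=> _ _ -> ->; exists f => //.
  rewrite (_ : chart_overlap _ _ _ = S°)//; apply/seteqP; split.
    by move=> _ [p _ <-]; exact: set_valP.
  by move=> x Sx; exists (exist _ x (mem_set Sx)).
- move=> p q /(congr1 set_val); rewrite !valF => /(congr1 h).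
  by rewrite !hK; [exact: val_inj|exact: set_valP..].
- move=> _ [A oA <-].
  exists (set_val @^-1` (S'° `&` h @^-1` (A `&` S°))).
    exists (S'° `&` h @^-1` (A `&` S°)) => //.
    rewrite openE => y [S1y Ahy] /=.
    apply: filterI; first exact: open_nbhs_nbhs (conj (open_interior S') S1y).
    apply: (ch y S1y); apply/open_nbhs_nbhs; split=> //.
    by apply: openI => //; exact: open_interior.
  apply/seteqP; split=> [q [p Ap <-]|q [[_ Ap] [p _ pq]]].
    split; last by exists p.
    split; first exact: set_valP.
    rewrite /preimage /= valF hK; last exact: set_valP.
    by split=> //; exact: set_valP.
  exists p => //; move: Ap.
  rewrite -pq /preimage /= valF hK; last exact: set_valP.
  by case.
- move=> _ _ g -> -> gE p _ _; rewrite /pullback /=.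
  have Sp := set_valP p.
  have -> : jacobian g (set_val p) = jacobian f (set_val p).
    apply: near_eq_jacobian; last exact: df.
    apply: filterS (open_nbhs_nbhs (conj (open_interior S) Sp)) => y Sy.
    by rewrite (gE (exist _ y (mem_set Sy))).
  by rewrite /domain_coord jf.
Qed.

(** * The area-preserving map from a rectangle to the unit disc *)

Section slice_angle.
Context (R : realType).
Implicit Types t s : R.

(** For t in [- pi / 2, pi / 2], the signed area of the part of the upper half of
    the unit disc that lies above the segment from 0 to sin t, that is, the
    integral of sqrt (1 - X^2) from 0 to sin t. *)
Definition disc_area t : R := (t + sin t * cos t) / 2.

Let is_derive_disc_area t : is_derive t 1 disc_area (cos t ^+ 2).
Proof.
have -> : disc_area = (fun t => 2^-1 *: (t + sin t * cos t)).
  by apply/funext => u; rewrite /disc_area mulrC.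
apply: is_derive_eq.
rewrite /GRing.scale /=.
have := cos2Dsin2 t; rewrite /=; set a := cos t; set b := sin t => ab.
rewrite mulrN -!expr2 (_ : b ^+ 2 = 1 - a ^+ 2); first by field.
by rewrite -ab; ring.
Qed.

Lemma continuous_disc_area : continuous disc_area.
Proof.
move=> t; apply/differentiable_continuous/derivable1_diffP.
by have [] := is_derive_disc_area t.
Qed.

Let pihalf_gt0 : 0 < pi / 2 :> R.
Proof. by rewrite divr_gt0// pi_gt0. Qed.

Lemma disc_area_lt :
  {in `[- (pi / 2), pi / 2]%R &, {homo disc_area : x y / x < y}}.
Proof.
apply: gtr0_derive1_lt_cc.
- by move=> t _; have [] := is_derive_disc_area t.
- move=> t tpi; rewrite derive1E; have [_ ->] := is_derive_disc_area t.
  by rewrite exprn_gt0// cos_gt0_pihalf.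
- exact/continuous_subspaceT/continuous_disc_area.
Qed.

Let disc_areaN : disc_area (- (pi / 2)) = - (pi / 4).
Proof. by rewrite /disc_area cosN cos_pihalf mulr0 addr0; field. Qed.

Let disc_areaP : disc_area (pi / 2) = pi / 4.
Proof. by rewrite /disc_area cos_pihalf mulr0 addr0; field. Qed.

Let itvP1 t : - (pi / 2) < t < pi / 2 -> t \in `[- (pi / 2), pi / 2]%R.
Proof. by case/andP => ? ?; rewrite in_itv/= !ltW. Qed.

Lemma disc_area_bound t : - (pi / 2) < t < pi / 2 ->
  - (pi / 4) < disc_area t < pi / 4.
Proof.
move=> tpi; have tI := itvP1 tpi; case/andP: tpi => t1 t2.
have le : - (pi / 2) <= pi / 2 :> R by rewrite (le_trans (ltW t1)) ?ltW.
by rewrite -disc_areaN -disc_areaP !disc_area_lt// in_itv/= ?lexx ?le.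
Qed.

Lemma disc_area_surj s : - (pi / 4) < s < pi / 4 ->
  exists t, - (pi / 2) < t < pi / 2 /\ disc_area t = s.
Proof.
move=> /andP[s1 s2].
have [|//||t] := @IVT _ disc_area (- (pi / 2)) (pi / 2) s.
- by rewrite ge0_cp// ltW.
- exact/continuous_subspaceT/continuous_disc_area.
- rewrite disc_areaN disc_areaP minEle maxEle.
  by rewrite (le_trans (ltW s1))// ?ltW// !ltW.
rewrite in_itv/= !le_eqVlt => /andP[/predU1P[<-|t1]].
  by rewrite disc_areaN => _ E; move: s1; rewrite -E ltxx.
move=> /predU1P[->|t2]; last by move=> <-; exists t; rewrite t1 t2.
by rewrite disc_areaP => E; move: s2; rewrite -E ltxx.
Qed.

(** The inverse of [disc_area], meant for ]- pi / 4, pi / 4[. *)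
Definition slice_angle s : R :=
  xget 0 [set t | - (pi / 2) < t < pi / 2 /\ disc_area t = s].

Lemma slice_angleP s : - (pi / 4) < s < pi / 4 ->
  - (pi / 2) < slice_angle s < pi / 2 /\ disc_area (slice_angle s) = s.
Proof.
move=> /disc_area_surj[t tP].
by rewrite /slice_angle; case: xgetP => [u _ //|/(_ t)].
Qed.

Lemma disc_areaK t : - (pi / 2) < t < pi / 2 -> slice_angle (disc_area t) = t.
Proof.
move=> tpi; have [tpi' E] := slice_angleP (disc_area_bound tpi).
have := disc_area_lt (itvP1 tpi) (itvP1 tpi').
have := disc_area_lt (itvP1 tpi') (itvP1 tpi).
rewrite E ltxx; case: ltgtP => //.
  by move=> _ /(_ isT).
by move=> _ _ /(_ isT).
Qed.

Lemma cos_slice_angle_gt0 s : - (pi / 4) < s < pi / 4 ->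
  0 < cos (slice_angle s).
Proof. by move=> /slice_angleP[? _]; exact: cos_gt0_pihalf. Qed.

Lemma is_derive_slice_angle s : - (pi / 4) < s < pi / 4 ->
  is_derive s 1 slice_angle (cos (slice_angle s) ^- 2).
Proof.
move=> sI; have [tI E] := slice_angleP sI; rewrite -{1}E.
apply: is_derive_inverse; last first.
- by rewrite gt_eqF// exprn_gt0// cos_slice_angle_gt0.
- exact: is_derive_disc_area.
- by near=> u; exact: continuous_disc_area.
- have tI' : slice_angle s \in `]- (pi / 2), pi / 2[ by rewrite in_itv.
  by apply: filterS (near_in_itvoo tI') => u; rewrite in_itv; exact: disc_areaK.
Unshelve. all: by end_near. Qed.

End slice_angle.

Lemma derive_coord (R : realType) (m : nat) (z v : 'rV[R]_m) j :
  'D_v (fun y : 'rV[R]_m => y 0 j) z = v 0 j.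
Proof.
have := @derive_mx R 'rV[R]_m 1 m id z v (@derivable_id _ _ _ _).
by rewrite derive_id => /rowP/(_ j); rewrite mxE => ->.
Qed.

Lemma derive_comp_coord (R : realType) (m : nat) (g : R -> R) (a : R)
    (z v : 'rV[R]_m) j : is_derive (z 0 j) 1 g a ->
  differentiable (fun y : 'rV[R]_m => g (y 0 j)) z /\
  'D_v (fun y : 'rV[R]_m => g (y 0 j)) z = a * v 0 j.
Proof.
move=> [dg ga]; have dc := differentiable_coord z 0 j.
have dg' : differentiable g (z 0 j) by exact/derivable1_diffP.
have dF : differentiable (fun y : 'rV[R]_m => g (y 0 j)) z.
  exact: (differentiable_comp dc dg').
split => //; rewrite deriveE//.
rewrite (_ : (fun y : 'rV[R]_m => g (y 0 j)) =
  g \o (fun y : 'rV[R]_m => y 0 j))//.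
have dcv : 'd (fun y : 'rV[R]_m => y 0 j) z v = v 0 j.
  by rewrite -[LHS](deriveE _ dc) derive_coord.
rewrite diff_comp//.
rewrite -[LHS]/('d g (z 0 j) ('d (fun y : 'rV[R]_m => y 0 j) z v)) dcv.
by rewrite deriv1E// derive1E ga mulrC.
Qed.

Lemma sqr_lt1 (R : realDomainType) (x : R) : (x ^+ 2 < 1) = (-1 < x < 1).
Proof. by rewrite -ltr_norml -(ger0_norm (sqr_ge0 x)) normrX expr_lt1. Qed.

Lemma continuous_row (R : realType) (m p : nat) (f : 'rV[R]_m -> 'rV[R]_p)
    (z : 'rV[R]_m) :
  (forall j, {for z, continuous (fun y => f y 0 j)}) -> {for z, continuous f}.
Proof.
have FF : Filter (nbhs z) := @nbhs_filter 'rV[R]_m z.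
move=> cf; apply/(@cvgrPdist_lt _ _ _ (nbhs z)) => e e0.
have H : \forall y \near z, forall j, `|f z 0 j - f y 0 j| < e.
  apply: (filter_forall (F := nbhs z)) => j.
  by have /(@cvgrPdist_lt _ _ _ (nbhs z))/(_ e e0) := cf j.
apply: filterS H => y fy.
rewrite [ltLHS]/Num.Def.normr/= mx_normrE.
apply/bigmax_ltP; split=> // -[i j] _.
by rewrite !mxE ord1; exact: fy.
Qed.

Section rectangle_into_disc.
Context (R : realType) (n : nat).
Notation N := n.+1.
Notation l0 := (lshift N (@ord0 n)).
Notation r0 := (rshift N (@ord0 n)).
Implicit Types z w : 'rV[R]_(N + N).

Definition rectangle_tube : set 'rV[R]_(N + N) :=
  [set z | - (pi / 4) < z 0 l0 < pi / 4 /\ -1 < z 0 r0 < 1].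

Lemma open_rectangle_tube : open rectangle_tube.
Proof.
have -> : rectangle_tube =
    (fun z => z 0 l0) @^-1` `](- (pi / 4)), (pi / 4)[%classic `&`
    (fun z => z 0 r0) @^-1` `](-1), 1[%classic.
  by apply/seteqP; split=> z; rewrite /rectangle_tube /= !in_itv.
apply: openI; (apply: open_comp; last exact: interval_open).
  by move=> z _; exact: coord_continuous.
by move=> z _; exact: coord_continuous.
Qed.

(** The point (x, y) of the rectangle goes to (sin t, y cos t), where t is the
    angle with [disc_area t] = x.  The half-chord of the disc above sin t has
    length cos t, so the image is in the disc; as the derivative of x |-> sin t
    is 1 / cos t, the factor cos t on y makes the map area-preserving. *)
Definition rectangle_disc_map z : 'rV[R]_(N + N) := \row_j
  if j == l0 then sin (slice_angle (z 0 l0))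
  else if j == r0 then z 0 r0 * cos (slice_angle (z 0 l0)) else z 0 j.

Definition disc_rectangle_map w : 'rV[R]_(N + N) := \row_j
  if j == l0 then disc_area (asin (w 0 l0))
  else if j == r0 then w 0 r0 * (cos (asin (w 0 l0)))^-1 else w 0 j.

Let rl0 : (r0 == l0) = false.
Proof. by rewrite eq_rlshift. Qed.

Lemma rectangle_disc_mapK z : rectangle_tube z ->
  disc_rectangle_map (rectangle_disc_map z) = z.
Proof.
move=> [z1 z2]; have [tI E] := slice_angleP z1.
apply/rowP => j; rewrite !mxE !eqxx rl0.
rewrite sinK; last by move: tI => /andP[? ?]; rewrite in_itv/= !ltW.
have [->|_] := eqVneq j l0; first exact: E.
have [->|//] := eqVneq j r0.
by rewrite mulfK// gt_eqF// cos_slice_angle_gt0.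
Qed.

Lemma rectangle_disc_map_cylinder z : rectangle_tube z ->
  symplectic_cylinder (rectangle_disc_map z).
Proof.
move=> [z1 z2] i i0.
have -> : i = ord0 by exact/val_inj.
rewrite !mxE !eqxx rl0 exprMn -[ltRHS](cos2Dsin2 (slice_angle (z 0 l0))).
rewrite addrC ltrD2r gtr_pMl ?exprn_gt0 ?cos_slice_angle_gt0//.
by rewrite sqr_lt1.
Qed.

Lemma open_symplectic_cylinder : open (@symplectic_cylinder R N).
Proof.
rewrite (_ : @symplectic_cylinder R N =
  (fun z => z 0 l0 ^+ 2 + z 0 r0 ^+ 2) @^-1` [set x | x < 1]); last first.
  apply/seteqP; split=> z; first by move/(_ ord0 erefl).
  by move=> h i i0; have -> : i = ord0 by exact/val_inj.
apply: open_comp => [z _|]; last exact: open_lt.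
have sq j : differentiable (fun y : 'rV[R]_(N + N) => y 0 j ^+ 2) z.
  exact: (differentiableM (differentiable_coord z 0 j)
                          (differentiable_coord z 0 j)).
exact/differentiable_continuous/(differentiableD (sq l0) (sq r0)).
Qed.

Lemma continuous_disc_rectangle_map w : symplectic_cylinder w ->
  {for w, continuous disc_rectangle_map}.
Proof.
move=> /(_ ord0 erefl) wc.
have w1 : -1 < w 0 l0 < 1.
  rewrite -sqr_lt1; apply: le_lt_trans wc.
  by rewrite lerDl sqr_ge0.
have ca : {for w, continuous (fun y : 'rV[R]_(N + N) => asin (y 0 l0))}.
  apply: (@continuous_comp _ _ _ (fun y : 'rV[R]_(N + N) => y 0 l0) asin).
    exact: coord_continuous.
  exact: continuous_asin.
apply: continuous_row => j.
rewrite (_ : (fun y => disc_rectangle_map y 0 j) = fun y =>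
  if j == l0 then disc_area (asin (y 0 l0))
  else if j == r0 then y 0 r0 * (cos (asin (y 0 l0)))^-1 else y 0 j);
    last first.
  by apply/funext => y; rewrite mxE.
have [_|_] := eqVneq j l0.
  apply: (@continuous_comp _ _ _ _ (@disc_area R)) => //.
  exact: continuous_disc_area.
have [_|_] := eqVneq j r0; last exact: coord_continuous.
apply: continuousM; first exact: coord_continuous.
apply: continuousV.
  by rewrite gt_eqF// cos_gt0_pihalf// asin_gtNpi2 ?asin_ltpi2//;
    case/andP: w1 => ? ?; apply/andP; split => //; exact: ltW.
apply: (@continuous_comp _ _ _ _ (@cos R)) => //.
exact: continuous_cos.
Qed.

End rectangle_into_disc.

Section slice_derivatives.
Context (R : realType) (x : R).
Hypothesis xI : - (pi / 4) < x < pi / 4.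
Let dx := is_derive_slice_angle xI.
Let c0 : cos (slice_angle x) != 0.
Proof. by rewrite gt_eqF// cos_slice_angle_gt0. Qed.

Lemma is_derive_sin_slice :
  is_derive x 1 (fun y => sin (slice_angle y)) (cos (slice_angle x))^-1.
Proof.
have := is_derive1_comp (is_derive_sin (slice_angle x)) dx => H.
apply: (is_derive_eq H); by field.
Qed.

Lemma is_derive_cos_slice :
  is_derive x 1 (fun y => cos (slice_angle y))
    (- sin (slice_angle x) * (cos (slice_angle x))^-1 ^+ 2).
Proof.
have := is_derive1_comp (is_derive_cos (slice_angle x)) dx => H.
apply: (is_derive_eq H); by field.
Qed.

Lemma is_derive_sec_slice :
  is_derive x 1 (fun y => (cos (slice_angle y))^-1)
    (sin (slice_angle x) * (cos (slice_angle x))^-1 ^+ 4).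
Proof.
have H := is_deriveV c0 is_derive_cos_slice.
apply: (is_derive_eq H); rewrite /GRing.scale/=; by field.
Qed.

End slice_derivatives.

Section rectangle_disc_smooth.
Context (R : realType) (n : nat).
Notation N := n.+1.
Notation l0 := (lshift N (@ord0 n)).
Notation r0 := (rshift N (@ord0 n)).
Notation tube := (@rectangle_tube R n).
Implicit Types z v : 'rV[R]_(N + N).

Let s z : R := sin (slice_angle (z 0 l0)).
Let co z : R := cos (slice_angle (z 0 l0)).
Let se z : R := (cos (slice_angle (z 0 l0)))^-1.

(** The secant is a generator as well: it appears in the derivatives of the sine
    and the cosine of the angle. *)
Let gens : set ('rV[R]_(N + N) -> R) :=
  [set g | (exists j, g = fun z => z 0 j) \/ [\/ g = s, g = co | g = se]].

Let gen_coord j : generated_ring gens (fun z => z 0 j).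
Proof. by apply: generator; left; exists j. Qed.
Let gen_s : generated_ring gens s.
Proof. by apply: generator; right; constructor 1. Qed.
Let gen_co : generated_ring gens co.
Proof. by apply: generator; right; constructor 2. Qed.
Let gen_se : generated_ring gens se.
Proof. by apply: generator; right; constructor 3. Qed.

Let ds z v : tube z -> differentiable s z /\ 'D_v s z = se z * v 0 l0.
Proof. by move=> [zI _]; exact: derive_comp_coord (is_derive_sin_slice zI). Qed.

Let dco z v : tube z ->
  differentiable co z /\ 'D_v co z = - s z * se z ^+ 2 * v 0 l0.
Proof. by move=> [zI _]; exact: derive_comp_coord (is_derive_cos_slice zI). Qed.

Let dse z v : tube z ->
  differentiable se z /\ 'D_v se z = s z * se z ^+ 4 * v 0 l0.
Proof. by move=> [zI _]; exact: derive_comp_coord (is_derive_sec_slice zI). Qed.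

Let gens_differentiable b : gens b -> forall z, tube z -> differentiable b z.
Proof.
move=> [[j ->]|[->|->|->]] z tz.
- exact: differentiable_coord.
- exact: (ds 0 tz).1.
- exact: (dco 0 tz).1.
- exact: (dse 0 tz).1.
Qed.

Let gens_derive b : gens b -> forall i, exists2 g, generated_ring gens g &
  forall z, tube z -> 'D_(delta_mx 0 i) b z = g z.
Proof.
have gen_X k g : generated_ring gens g ->
    generated_ring gens (fun z => g z ^+ k).
  move=> rg; elim: k => [|k IHk]; first exact: generated_cst.
  rewrite (_ : (fun z => _) = fun z => g z * g z ^+ k); last first.
    by apply/funext => z; rewrite exprS.
  exact: generated_mul.
move=> [[j ->]|[->|->|->]] i.
- exists (fun=> (delta_mx 0 i : 'rV[R]_(N + N)) 0 j).
    exact: generated_cst.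
  by move=> z _; exact: derive_coord.
- exists (fun z => se z * (delta_mx 0 i : 'rV[R]_(N + N)) 0 l0).
    by apply: generated_mul => //; exact: generated_cst.
  by move=> z tz; rewrite (ds _ tz).2.
- exists (fun z => -1 * s z * se z ^+ 2 * (delta_mx 0 i : 'rV[R]_(N + N)) 0 l0).
    apply: generated_mul; last exact: generated_cst.
    apply: generated_mul; last exact: gen_X.
    by apply: generated_mul => //; exact: generated_cst.
  by move=> z tz; rewrite (dco _ tz).2 mulN1r.
- exists (fun z => s z * se z ^+ 4 * (delta_mx 0 i : 'rV[R]_(N + N)) 0 l0).
    apply: generated_mul; last exact: generated_cst.
    by apply: generated_mul => //; exact: gen_X.
  by move=> z tz; rewrite (dse _ tz).2.
Qed.

Let f := @rectangle_disc_map R n.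

Let f_coord j : (fun z => f z 0 j) = if j == l0 then s
  else if j == r0 then (fun z => z 0 r0 * co z) else (fun z => z 0 j).
Proof. by apply/funext => z; rewrite mxE; do 2 case: ifP => // _. Qed.

Let gen_f j : generated_ring gens (fun z => f z 0 j).
Proof.
rewrite f_coord; case: ifP => // _; case: ifP => // _.
exact: generated_mul.
Qed.

Lemma smooth_rectangle_disc_map : smooth_on tube f.
Proof.
apply: (generated_smooth (@open_rectangle_tube R n) gens_differentiable
  gens_derive) => j.
by exists (fun z => f z 0 j); [exact: gen_f|].
Qed.

Lemma differentiable_rectangle_disc_map z : tube z -> differentiable f z.
Proof.
move=> tz; apply: differentiable_row => j.
exact: (generated_differentiable gens_differentiable (gen_f j)).
Qed.

Let e : 'M[R]_N := delta_mx ord0 ord0.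

Lemma jacobian_rectangle_disc_map z : tube z -> jacobian f z =
  block_mx (1%:M + (se z - 1) *: e) ((z 0 r0 * (- s z * se z ^+ 2)) *: e)
           0 (1%:M + (co z - 1) *: e).
Proof.
move=> tz; have df := differentiable_rectangle_disc_map tz.
apply/matrixP => i j.
have -> : jacobian f z i j = 'D_(delta_mx 0 i) (fun z => f z 0 j) z.
  have := deriveEjacobian (delta_mx 0 i) df; rewrite -rowE => /rowP/(_ j).
  by rewrite mxE => <-; rewrite derive_mx ?mxE//; exact: diff_derivable.
have -> : 'D_(delta_mx 0 i) (fun z => f z 0 j) z =
  if j == l0 then se z * (i == l0)%:R
  else if j == r0 then z 0 r0 * (- s z * se z ^+ 2 * (i == l0)%:R) +
                       co z * (i == r0)%:R
  else (i == j)%:R.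
  have dl k : (delta_mx 0 i : 'rV[R]_(N + N)) 0 k = (i == k)%:R.
    by rewrite mxE eqxx eq_sym.
  rewrite f_coord; case: ifP => _; first by rewrite (ds _ tz).2 dl.
  case: ifP => _; last by rewrite derive_coord dl.
  rewrite [LHS]deriveM; last 2 first.
  - exact/diff_derivable/differentiable_coord.
  - exact/diff_derivable/(dco 0 tz).1.
  by rewrite derive_coord (dco _ tz).2 !dl.
rewrite -[i]splitK -[j]splitK.
case: (fintype.split i) => {}i; case: (fintype.split j) => {}j /=.
- rewrite block_mxEul !mxE ?(eq_lshift, eq_rshift, eq_lrshift, eq_rlshift).
  have : j == ord0 -> (i == j) = (i == ord0) by move/eqP->.
  case: (j == ord0) => [/(_ isT) ->|_]; case: (i == ord0) => /=; ring.
- rewrite block_mxEur !mxE ?(eq_lshift, eq_rshift, eq_lrshift, eq_rlshift).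
  case: (j == ord0); case: (i == ord0) => /=; ring.
- rewrite block_mxEdl !mxE ?(eq_lshift, eq_rshift, eq_lrshift, eq_rlshift).
  by case: ifP; rewrite ?mulr0.
- rewrite block_mxEdr !mxE ?(eq_lshift, eq_rshift, eq_lrshift, eq_rlshift).
  have : j == ord0 -> (i == j) = (i == ord0) by move/eqP->.
  case: (j == ord0) => [/(_ isT) ->|_]; case: (i == ord0) => /=; ring.
Qed.

(** The blocks P and Q of the Jacobian are inverse to each other because the
    secant times the cosine is 1, and the off-diagonal block commutes with P;
    these two identities are all that the symplectic condition asks for. *)
Lemma rectangle_disc_map_symplectic z : tube z ->
  jacobian f z *m standard_form_mx R N *m (jacobian f z)^T =
  standard_form_mx R N.
Proof.
move=> tz; rewrite jacobian_rectangle_disc_map//.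
have cose : se z * co z = 1.
  by rewrite mulVf// gt_eqF//; case: tz => /cos_slice_angle_gt0.
have eT : e^T = e by rewrite trmx_delta.
have ee : e *m e = e by rewrite mul_delta_mx.
set c := _ * _; set p := se z - 1; set q := co z - 1.
have PQ : (1%:M + p *: e) *m (1%:M + q *: e) = 1%:M.
  rewrite mulmxDl !mulmxDr !mul1mx mulmx1 -scalemxAl -scalemxAr ee scalerA.
  rewrite -addrA -!scalerDl (_ : q + (p + p * q) = se z * co z - 1).
    by rewrite cose subrr scale0r addr0.
  by rewrite /p /q; ring.
have QP : (1%:M + q *: e) *m (1%:M + p *: e) = 1%:M by exact: mulmx1C.
have Pe (a : R) : (1%:M + a *: e) *m (c *: e) = (c *: e) *m (1%:M + a *: e).
  rewrite mulmxDl mulmxDr mul1mx mulmx1 -!scalemxAl -!scalemxAr.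
  by rewrite !scalerA mulrC.
rewrite /standard_form_mx tr_block_mx !linearD/= !linearZ/= !trmx1 eT trmx0.
rewrite !mulmx_block.
rewrite !(mulmx0, mul0mx, mulmx1, mul1mx, addr0, add0r, mulmxN, mulNmx).
by rewrite PQ QP Pe addNr.
Qed.

End rectangle_disc_smooth.

Lemma capacity_rectangle_tube (R : realType) (n : nat)
    (c : symplectic_capacity R n.+1) :
  (capacity c (@rectangle_tube R n) <= (pi : R)%:E)%E.
Proof.
have tubeE : (@rectangle_tube R n)° = @rectangle_tube R n.
  exact/interior_id/open_rectangle_tube.
have cylE : (@symplectic_cylinder R n.+1)° = @symplectic_cylinder R n.+1.
  exact/interior_id/open_symplectic_cylinder.
rewrite -(capacity_cylinder c) -[leLHS]mul1e.
apply: (@capacity_le_embedding R n.+1 c _ _ (@rectangle_disc_map R n)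
  (@disc_rectangle_map R n)) => //; rewrite ?tubeE ?cylE.
- exact: rectangle_disc_map_cylinder.
- exact: smooth_rectangle_disc_map.
- exact: differentiable_rectangle_disc_map.
- by move=> z tz; rewrite scale1r; exact: rectangle_disc_map_symplectic.
- exact: rectangle_disc_mapK.
- exact: continuous_disc_rectangle_map.
Qed.

(** * Linear conformal maps and the slab between two pairs of hyperplanes *)

Section linear_map.
Context (R : realType) (m p : nat) (M : 'M[R]_(m, p)).

Lemma differentiable_mulmxr (z : 'rV[R]_m) : differentiable (mulmxr M) z.
Proof.
apply: differentiable_row => j.
rewrite (_ : (fun y => _) = \sum_(k < m) (fun y : 'rV[R]_m => y 0 k * M k j)).
  apply: differentiable_sum => k; apply: differentiableM => //.
  exact: differentiable_coord.
by apply/funext => y; rewrite fct_sumE mxE.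
Qed.

Lemma continuous_mulmxr : continuous (mulmxr M : 'rV[R]_m -> 'rV[R]_p).
Proof. by move=> z; exact/differentiable_continuous/differentiable_mulmxr. Qed.

Lemma derive_mulmxr (z v : 'rV[R]_m) : 'D_v (mulmxr M) z = v *m M.
Proof.
rewrite deriveE; last exact: differentiable_mulmxr.
by rewrite (@diff_lin _ _ _ (mulmxr M)); last exact: continuous_mulmxr.
Qed.

Lemma smooth_mulmxr (U : set 'rV[R]_m) :
  smooth_on U (mulmxr M : 'rV[R]_m -> 'rV[R]_p).
Proof.
case=> [|k]; (split; first by move=> x _; exact: continuous_mulmxr) => //.
move=> i; split=> [x _|]; first exact/diff_derivable/differentiable_mulmxr.
rewrite (_ : 'D_(delta_mx 0 i) _ = cst (delta_mx 0 i *m M)).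
  exact: Ck_on_cst.
by apply/funext => x; rewrite derive_mulmxr.
Qed.

Lemma jacobian_mulmxr (z : 'rV[R]_m) :
  jacobian (mulmxr M : 'rV[R]_m -> 'rV[R]_p) z = M.
Proof.
apply/row_matrixP => i; rewrite !rowE -[RHS](derive_mulmxr z).
by rewrite deriveEjacobian//; exact: differentiable_mulmxr.
Qed.

End linear_map.

Lemma capacity_le_linear (R : realType) (n : nat)
    (c : symplectic_capacity R n) (S S' : set 'rV[R]_(n + n))
    (M M' : 'M[R]_(n + n)) (alpha : R) :
  0 < alpha -> M *m M' = 1%:M ->
  M *m standard_form_mx R n *m M^T = alpha *: standard_form_mx R n ->
  (forall z, S° z -> S'° (z *m M)) ->
  (alpha%:E * capacity c S <= capacity c S')%E.
Proof.
move=> a0 MM' symM fS.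
have jf (z : 'rV[R]_(n + n)) : S° z ->
    jacobian (mulmxr M : 'rV[R]_(n + n) -> 'rV[R]_(n + n)) z *m
      standard_form_mx R n *m
      (jacobian (mulmxr M : 'rV[R]_(n + n) -> 'rV[R]_(n + n)) z)^T =
    alpha *: standard_form_mx R n.
  by move=> _; rewrite jacobian_mulmxr.
have fK (z : 'rV[R]_(n + n)) : S° z -> mulmxr M' (mulmxr M z) = z.
  by move=> _; rewrite /= -mulmxA MM' mulmx1.
have df (z : 'rV[R]_(n + n)) : S° z -> differentiable (mulmxr M) z.
  by move=> _; exact: differentiable_mulmxr.
have ch (z : 'rV[R]_(n + n)) : S'° z ->
    {for z, continuous (mulmxr M' : 'rV[R]_(n + n) -> 'rV[R]_(n + n))}.
  by move=> _; exact: continuous_mulmxr.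
exact: (capacity_le_embedding c a0 fS (smooth_mulmxr M S°) df jf fK ch).
Qed.

Lemma unitmx_mul_delta (F : fieldType) (n : nat) (u : 'rV[F]_n.+1) (a : F) :
  a != 0 -> u != 0 ->
  exists2 B : 'M[F]_n.+1, B \in unitmx & u *m B = a *: delta_mx 0 0.
Proof.
move=> a0 u0; have ru : \rank u = 1%N by rewrite rank_rV u0.
set s := col_ebase u 0 0.
have s0 : s != 0.
  have := col_ebase_unit u; rewrite unitmxE det_mx11 unitfE.
  by [].
exists ((a / s) *: invmx (row_ebase u)).
  by rewrite unitmxZ ?unitmx_inv ?row_ebase_unit// unitfE mulf_neq0 ?invr_eq0.
rewrite -{1}(mulmx_ebase u) ru -scalemxAr mulmxK ?row_ebase_unit//.
rewrite [col_ebase u]mx11_scalar mul_scalar_mx -/s scalerA divfK//.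
congr (_ *: _); apply/matrixP => i j; rewrite !mxE !ord1.
by rewrite eq_sym; case: j => -[|j].
Qed.

(** A change of basis in which both u and v become multiples of the first
    coordinate vector, u as a linear form and v as a vector.  First normalize u
    alone; then v has nonzero first coordinate, and a shear that fixes u clears
    its other coordinates. *)
Lemma adapted_unitmx (F : fieldType) (n : nat) (u v : 'rV[F]_n.+1) (a : F) :
  a != 0 -> u *m v^T = a%:M ->
  exists2 A : 'M[F]_n.+1, A \in unitmx &
    u *m A = a *: delta_mx 0 0 /\ A *m (delta_mx 0 0)^T = v^T.
Proof.
move=> a0 uv; have u0 : u != 0.
  apply: contraNneq a0 => u0; move: uv; rewrite u0 mul0mx => /matrixP/(_ 0 0).
  by rewrite !mxE eqxx mulr1n => <-.
have [B uB uBE] := unitmx_mul_delta a0 u0.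
set e0 : 'rV[F]_n.+1 := delta_mx 0 0.
have e0e0 : e0 *m e0^T = 1%:M.
  by rewrite trmx_delta mul_delta_mx; apply/matrixP => i j; rewrite !mxE !ord1.
pose w := invmx B *m v^T.
have e0w : e0 *m w = 1%:M.
  apply: (scalerI a0); rewrite scalemxAl -uBE /w -mulmxA mulKVmx// uv.
  by rewrite scale_scalar_mx mulr1.
pose C : 'M[F]_n.+1 := 1%:M + (w - e0^T) *m e0.
have e0C : e0 *m C = e0.
  by rewrite mulmxDr mulmx1 mulmxA mulmxBr e0w e0e0 subrr mul0mx addr0.
exists (B *m C).
  rewrite unitmx_mul uB /=.
  apply: (proj1 (@mulmx1_unit _ _ C (1%:M - (w - e0^T) *m e0) _)).
  have Cd : C *m (w - e0^T) = w - e0^T.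
    rewrite mulmxDl mul1mx -mulmxA mulmxBr e0w e0e0 subrr.
    by rewrite mulmx0 addr0.
  by rewrite mulmxBr mulmx1 mulmxA Cd /C addrK.
split; first by rewrite mulmxA uBE -scalemxAl e0C.
have -> : B *m C *m e0^T = B *m w.
  rewrite -mulmxA; congr (_ *m _).
  by rewrite [LHS]mulmxDl mul1mx -mulmxA e0e0 mulmx1 addrC subrK.
by rewrite /w mulKVmx.
Qed.

(** A slightly dilated interior point is still in S, where the bound holds. *)
Lemma interior_bound_lt (R : realType) (V : normedModType R) (S : set V)
    (l : V -> R) : (forall a z, l (a *: z) = a * l z) ->
  (forall z, S z -> `|l z| <= 1) -> forall z, S° z -> `|l z| < 1.
Proof.
move=> lZ lS z Sz.
have : \forall t \near (1 : R), S (t *: z).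
  have cz : t *: z @[t --> (1 : R)] --> z.
    rewrite -[X in _ --> X]scale1r; apply: cvgZr_tmp; exact: cvg_id.
  exact: (cz _ Sz).
move=> H.
have [t [St t1]] : exists t, S (t *: z) /\ 1 < t.
  near (1 : R)^'+ => t; exists t; split; near: t; last exact: nbhs_right_gt.
  exact: cvg_within H.
have [->|lz] := eqVneq (l z) 0; first by rewrite normr0.
have := lS _ St; rewrite lZ normrM gtr0_norm ?(lt_trans _ t1)//.
apply: lt_le_trans; by rewrite ltr_pMl// normr_gt0.
Unshelve. all: by end_near. Qed.

(** Up to a linear symplectic map, the slab |<q, X>| <= 1, |<x, Y>| <= 1 is the
    product of a rectangle of area 4 / <q, x> with R^(2n-2), so this area bounds
    its capacity.  The conformal factor b makes the area equal to pi. *)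
Lemma capacity_between_hyperplanes (R : realType) (n : nat)
    (c : symplectic_capacity R n.+1) (S : set 'rV[R]_(n.+1 + n.+1))
    (q x : 'rV[R]_n.+1) (a : R) :
  0 < a -> \sum_i q 0 i * x 0 i = a ->
  (forall z, S z -> `|\sum_i q 0 i * lsubmx z 0 i| <= 1) ->
  (forall z, S z -> `|\sum_i x 0 i * rsubmx z 0 i| <= 1) ->
  (capacity c S <= (4 / a)%:E)%E.
Proof.
move=> a0 qx Sq Sx.
pose b : R := pi / 4 * a.
have b0 : 0 < b by rewrite mulr_gt0// divr_gt0// pi_gt0.
have bneq : b != 0 by rewrite gt_eqF.
have xq : x *m ((pi / 4) *: q)^T = b%:M.
  apply/matrixP => i j; rewrite !ord1 !mxE eqxx mulr1n /b -qx mulr_sumr.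
  by apply: eq_bigr => k _; rewrite !mxE; ring.
have [A uA [xA Aq]] := adapted_unitmx bneq xq.
pose D := b *: (invmx A)^T.
pose M := block_mx A 0 0 D.
pose M' := block_mx (invmx A) 0 0 (b^-1 *: A^T).
have MM' : M *m M' = 1%:M.
  rewrite mulmx_block !(mulmx0, mul0mx, addr0, add0r) mulmxV// /D.
  rewrite -scalemxAl -scalemxAr scalerA mulfV// scale1r -trmx_mul mulmxV//.
  by rewrite trmx1 -scalar_mx_block.
have dot0 (u : 'rV[R]_n.+1) (B : 'M[R]_n.+1) (w : 'rV[R]_n.+1) :
    B *m (delta_mx 0 0 : 'rV[R]_n.+1)^T = w^T ->
    (u *m B) 0 0 = \sum_i w 0 i * u 0 i.
  move=> Bw; transitivity ((u *m B *m (delta_mx 0 0 : 'rV[R]_n.+1)^T) 0 0).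
    by rewrite trmx_delta -colE [RHS]mxE.
  by rewrite -mulmxA Bw mxE; apply: eq_bigr => i _; rewrite mxE mulrC.
have Dx : D *m (delta_mx 0 0 : 'rV[R]_n.+1)^T = x^T.
  rewrite /D -scalemxAl -trmx_mul -linearZ /= scalemxAl -xA -mulmxA.
  by rewrite mulmxV// mulmx1.
have Ml (z : 'rV[R]_(n.+1 + n.+1)) :
    (z *m M) 0 (lshift _ 0) = pi / 4 * \sum_i q 0 i * lsubmx z 0 i.
  rewrite -{1}[z]hsubmxK mul_row_block !(mulmx0, addr0, add0r) row_mxEl.
  rewrite (dot0 _ _ _ Aq) mulr_sumr; apply: eq_bigr => i _.
  by rewrite !mxE; ring.
have Mr (z : 'rV[R]_(n.+1 + n.+1)) :
    (z *m M) 0 (rshift _ 0) = \sum_i x 0 i * rsubmx z 0 i.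
  rewrite -{1}[z]hsubmxK mul_row_block !(mulmx0, addr0, add0r) row_mxEr.
  exact: dot0.
have lin (w : 'rV[R]_n.+1) (P : 'rV[R]_(n.+1 + n.+1) -> 'rV[R]_n.+1) :
    (forall t z, P (t *: z) = t *: P z) ->
    forall t z, \sum_i w 0 i * P (t *: z) 0 i = t * \sum_i w 0 i * P z 0 i.
  move=> PZ t z; rewrite PZ mulr_sumr; apply: eq_bigr => i _.
  by rewrite !mxE; ring.
have fS (z : 'rV[R]_(n.+1 + n.+1)) : S° z -> (@rectangle_tube R n)° (z *m M).
  have -> : (@rectangle_tube R n)° = @rectangle_tube R n.
    exact/interior_id/open_rectangle_tube.
  move=> Sz; rewrite /rectangle_tube /= Ml Mr.
  have pi4 : 0 < pi / 4 :> R by rewrite divr_gt0// pi_gt0.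
  split; rewrite -ltr_norml; last first.
    apply: (interior_bound_lt (lin _ _ _) Sx Sz) => t y.
    by apply/rowP => i; rewrite !mxE.
  rewrite normrM gtr0_norm// gtr_pMr//.
  apply: (interior_bound_lt (lin _ _ _) Sq Sz) => t y.
  by apply/rowP => i; rewrite !mxE.
have : (b%:E * capacity c S <= (pi : R)%:E)%E.
  apply: le_trans (capacity_rectangle_tube c).
  apply: capacity_le_linear b0 MM' _ fS.
  rewrite /standard_form_mx tr_block_mx !mulmx_block.
  rewrite !(mulmx0, mul0mx, mulmx1, trmx0, addr0, add0r, mulmxN, mulNmx).
  rewrite /D linearZ /= trmxK -scalemxAr -scalemxAl mulmxV// -trmx_mul mulmxV//.
  by rewrite trmx1 scale_block_mx !scaler0 scalerN.
have an0 : a != 0 by rewrite gt_eqF.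
have pin0 : (pi : R) != 0 by rewrite gt_eqF// pi_gt0.
have -> : 4 / a = pi / b by rewrite /b invfM invf_div mulrA [pi * _]mulrC divfK.
by rewrite (EFinM pi) lee_pdivlMr// muleC.
Qed.

(** * Integration over tuples *)

Section lebesgue_tuple_integral.
Context (R : realType).
Local Open Scope ereal_scope.
Notation tup n := (n.-tuple (measurableTypeR R)).
Notation lambda := (@lebesgue_measure R).

Lemma lebesgue_tupleS n (A : set (tup n.+1)) :
  lebesgue_tuple R n.+1 A =
  (lambda \x^ lebesgue_tuple R n) (@tuple_cons R n @^-1` A).
Proof. by []. Qed.

Lemma measurable_tuple_box n (I : set R) : measurable I ->
  measurable [set t : tup n | forall i, I (tnth t i)].
Proof.
move=> mI.
have -> : [set t : tup n | forall i, I (tnth t i)] =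
    \bigcap_(i in [set: 'I_n]) ((fun t : tup n => tnth t i) @^-1` I).
  by apply/seteqP; split=> t h i *; exact: h.
apply: fin_bigcap_measurable => // i _.
by rewrite -[X in measurable X]setTI; exact: measurable_tnth.
Qed.

Lemma lebesgue_tuple_box n (I : set R) : measurable I ->
  lebesgue_tuple R n [set t | forall i, I (tnth t i)] = lambda I ^+ n.
Proof.
move=> mI; elim: n => [|n IHn].
  rewrite /= diracE mem_set ?expe0//.
  by case.
rewrite lebesgue_tupleS.
rewrite (_ : _ @^-1` _ = I `*` [set t | forall i, I (tnth t i)]).
  rewrite product_measure2E//; first by rewrite IHn expeS.
  exact: measurable_tuple_box.
apply/seteqP; split=> [[x t] /= h|[x t] /= [Ix h] i].
  split; first exact: (h ord0).
  by move=> i; have := h (lift ord0 i); rewrite tnthS.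
by have [j ->|->] := unliftP ord0 i; rewrite ?tnthS.
Qed.

Lemma lebesgue_tuple_sigma_finite n : sigma_finite setT (lebesgue_tuple R n).
Proof.
exists (fun k =>
  [set t | forall i, `[(- k%:R)%R : R, k%:R]%classic (tnth t i)]).
  apply/seteqP; split=> t // _.
  exists (\max_(i < n) Num.bound `|tnth t i|%R)%N => //= i.
  rewrite in_itv/= -ler_norml (le_trans (ltW (archi_boundP (normr_ge0 _))))//.
  rewrite ler_nat.
  exact: (leq_bigmax (F := fun i => Num.bound `|tnth t i|%R)).
move=> k; split; first exact: measurable_tuple_box.
by rewrite lebesgue_tuple_box// lebesgue_measure_itv/=; case: ifP => _;
  rewrite -?EFin_expe ?ltry// expe0n.
Qed.

(** A copy of [lebesgue_tuple R n] that can carry the structure of a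
    sigma-finite measure, which the theorem of Tonelli asks for. *)
Definition sf_lebesgue n : set (tup n) -> \bar R := lebesgue_tuple R n.

HB.instance Definition _ n := isMeasure.Build _ _ _ (@sf_lebesgue n)
  (measure0 (lebesgue_tuple R n)) (measure_ge0 (lebesgue_tuple R n))
  (@measure_semi_sigma_additive _ _ _ (lebesgue_tuple R n)).

HB.instance Definition _ n := Measure_isSigmaFinite.Build _ _ _ (@sf_lebesgue n)
  (lebesgue_tuple_sigma_finite n).

Lemma ge0_integral_lebesgue_tupleS n (f : tup n.+1 -> \bar R) :
  measurable_fun [set: tup n.+1] f -> (forall t, 0 <= f t) ->
  \int[lebesgue_tuple R n.+1]_t f t =
  \int[lebesgue_tuple R n]_t \int[lambda]_x f (tuple_cons (x, t)).
Proof.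
move=> mf f0.
have mfc : measurable_fun setT (f \o @tuple_cons R n).
  exact: measurableT_comp mf (@measurable_tuple_cons R n).
rewrite [LHS](@ge0_integral_pushforward _ _ _ _ _ _ (@measurable_tuple_cons R n)
  (lambda \x^ lebesgue_tuple R n) setT f)//.
transitivity (\int[lambda \x @sf_lebesgue n]_p (f \o @tuple_cons R n) p).
  apply: eq_measure_integral => A mA _ /=.
  apply/esym/product_measure_unique => // B C mB mC.
  by rewrite [LHS]product_measure2E.
by rewrite (fubini_tonelli2 (f \o @tuple_cons R n))// => p; exact: f0.
Qed.

Lemma measurable_integral_tuple_cons n (f : tup n.+1 -> \bar R) :
  measurable_fun [set: tup n.+1] f -> (forall t, 0 <= f t) ->
  measurable_fun [set: tup n] (fun t => \int[lambda]_x f (tuple_cons (x, t))).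
Proof.
move=> mf f0.
have mfc : measurable_fun setT (f \o @tuple_cons R n).
  exact: measurableT_comp mf (@measurable_tuple_cons R n).
have fc0 p : 0 <= (f \o @tuple_cons R n) p by exact: f0.
exact: (measurable_fun_fubini_tonelli_G (m1 := lambda) _ mfc fc0).
Qed.

End lebesgue_tuple_integral.

Section tuple_maps.
Context (R : realType).
Local Open Scope ereal_scope.
Notation tup n := (n.-tuple (measurableTypeR R)).
Notation lambda := (@lebesgue_measure R).

Definition tuple_take m n (t : tup (m + n)) : tup m :=
  [tuple tnth t (lshift n i) | i < m].
Definition tuple_drop m n (t : tup (m + n)) : tup n :=
  [tuple tnth t (rshift m i) | i < n].
Definition tuple_scale (a : R) n (t : tup n) : tup n :=
  [tuple (a * tnth t i)%R | i < n].

Lemma measurable_tuple_take m n :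
  measurable_fun [set: tup (m + n)] (@tuple_take m n).
Proof.
apply/measurable_fun_tnthP => i.
rewrite (_ : _ \o _ = fun t : tup (m + n) => tnth t (lshift n i)).
  exact: measurable_tnth.
by apply/funext => t /=; rewrite tnth_mktuple.
Qed.

Lemma measurable_tuple_drop m n :
  measurable_fun [set: tup (m + n)] (@tuple_drop m n).
Proof.
apply/measurable_fun_tnthP => i.
rewrite (_ : _ \o _ = fun t : tup (m + n) => tnth t (rshift m i)).
  exact: measurable_tnth.
by apply/funext => t /=; rewrite tnth_mktuple.
Qed.

Lemma measurable_tuple_scale a n :
  measurable_fun [set: tup n] (@tuple_scale a n).
Proof.
apply/measurable_fun_tnthP => i.
rewrite (_ : _ \o _ = fun t : tup n => (a * tnth t i)%R).
  by apply: measurable_funM => //; exact: measurable_tnth.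
by apply/funext => t /=; rewrite tnth_mktuple.
Qed.

Lemma tuple_take_cons m n (x : R) (t : tup (m + n)) :
  tuple_take (tuple_cons (x, t) : tup (m.+1 + n)) =
  tuple_cons (x, tuple_take t).
Proof.
apply: eq_from_tnth => i; rewrite tnth_mktuple.
have [j ->|->] := unliftP ord0 i.
  rewrite [RHS]tnthS tnth_mktuple.
  transitivity (tnth (tuple_cons (x, t)) (lift ord0 (lshift n j : 'I_(m + n)))).
    by congr (tnth _ _); exact: val_inj.
  exact: tnthS.
by transitivity (tnth (tuple_cons (x, t)) ord0).
Qed.

Lemma tuple_drop_cons m n (x : R) (t : tup (m + n)) :
  tuple_drop (tuple_cons (x, t) : tup (m.+1 + n)) = tuple_drop t.
Proof.
apply: eq_from_tnth => i; rewrite !tnth_mktuple.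
transitivity (tnth (tuple_cons (x, t)) (lift ord0 (rshift m i : 'I_(m + n)))).
  by congr (tnth _ _); exact: val_inj.
exact: tnthS.
Qed.

Lemma tuple_scale_cons a n (x : R) (t : tup n) :
  tuple_scale a (tuple_cons (x, t)) = tuple_cons ((a * x)%R, tuple_scale a t).
Proof.
apply: eq_from_tnth => i; rewrite tnth_mktuple.
have [j ->|->//] := unliftP ord0 i.
by rewrite [RHS]tnthS tnth_mktuple [X in (_ * X)%R]tnthS.
Qed.

(** One factor is a general function and not an indicator, since the induction
    on m integrates out one variable at a time and leaves such a function. *)
Lemma ge0_integral_tuple_product m n (f : tup m -> \bar R) (B : set (tup n)) :
  measurable_fun [set: tup m] f -> (forall t, 0 <= f t) -> measurable B ->
  \int[lebesgue_tuple R (m + n)]_t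
    (f (tuple_take t) * (\1_B (tuple_drop t))%:E) =
  \int[lebesgue_tuple R m]_t f t * lebesgue_tuple R n B.
Proof.
move=> + + mB.
have mg k (h : tup k -> \bar R) : measurable_fun [set: tup k] h ->
    measurable_fun [set: tup (k + n)]
      (fun t => h (tuple_take t) * (\1_B (tuple_drop t))%:E).
  move=> mh; apply: emeasurable_funM.
    exact: measurableT_comp mh (@measurable_tuple_take k n).
  apply/measurable_EFinP.
  exact: measurableT_comp (measurable_indic mB) (@measurable_tuple_drop k n).
elim: m f => [|m IHm] f mf f0.
  have -> : \int[lebesgue_tuple R 0]_t f t = f [tuple].
    transitivity (\int[\d_ ([tuple] : tup 0)]_t f t) => //.
    by rewrite integral_dirac//= diracT mul1e.
  rewrite -[X in lebesgue_tuple R n X]setIT -integral_indic//.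
  rewrite -ge0_integralZl//; last exact/measurable_EFinP/measurable_indic.
  apply: eq_integral => t _; congr (f _ * _).
    by apply: eq_from_tnth => -[].
  congr (\1_B _)%:E; apply: eq_from_tnth => i.
  by rewrite tnth_mktuple; congr (tnth _ _); exact: val_inj.
rewrite [LHS](@ge0_integral_lebesgue_tupleS R (m + n)); last 2 first.
- exact: (mg m.+1).
- by move=> t; rewrite mule_ge0// lee_fin.
rewrite ge0_integral_lebesgue_tupleS// -IHm; last 2 first.
- exact: measurable_integral_tuple_cons.
- by move=> t; exact: integral_ge0.
apply: eq_integral => t _.
rewrite -ge0_integralZr//; last first.
  exact: (measurableT_comp mf
    (measurable_cons (@measurable_id _ _ _) (measurable_cst _))).
by apply: eq_integral => x _; rewrite tuple_take_cons tuple_drop_cons.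
Qed.

Lemma lebesgue_tuple_product m n (A : set (tup m)) (B : set (tup n)) :
  measurable A -> measurable B ->
  lebesgue_tuple R (m + n) [set t | A (tuple_take t) /\ B (tuple_drop t)] =
  lebesgue_tuple R m A * lebesgue_tuple R n B.
Proof.
move=> mA mB.
have -> : [set t : tup (m + n) | A (tuple_take t) /\ B (tuple_drop t)] =
    (@tuple_take m n @^-1` A) `&` (@tuple_drop m n @^-1` B) by [].
have mAB : measurable ((@tuple_take m n @^-1` A) `&` (@tuple_drop m n @^-1` B)).
  apply: measurableI; rewrite -[X in measurable X]setTI.
    exact: measurable_tuple_take.
  exact: measurable_tuple_drop.
rewrite -[X in lebesgue_tuple R (m + n) X]setIT -integral_indic//.
rewrite -[X in lebesgue_tuple R m X]setIT -integral_indic//.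
rewrite -ge0_integral_tuple_product//.
- apply: eq_integral => t _; rewrite -EFinM; congr _%:E.
  by rewrite indicI.
- exact/measurable_EFinP/measurable_indic.
Qed.

(** The preimage of the interval ]u, v] under multiplication by a is
    ]u / a, v / a], and the half-open intervals determine the measure. *)
Lemma lebesgue_measure_scale (a : R) (A : set R) : (0 < a)%R -> measurable A ->
  a%:E * lambda [set x | A (a * x)%R] = lambda A.
Proof.
move=> a0 mA.
have ms : measurable_fun setT
    (fun x : measurableTypeR R => (a * x)%R : measurableTypeR R).
  exact: measurable_funM.
pose pf : {measure set (measurableTypeR R) -> \bar R} :=
  measure_function_pushforward__canonical__measure_function_Measure lambda ms.
pose mu := mscale (NngNum (ltW a0)) pf.
apply/esym/(@lebesgue_measure_unique R mu) => //= _ [[u v]] _ <-.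
rewrite /mu /mscale /= /pushforward.
have -> : (fun x : measurableTypeR R => (a * x)%R) @^-1` `]u, v] =
    `](u / a)%R, (v / a)%R]%classic.
  apply/seteqP; split=> x /=; rewrite !in_itv/= ltr_pdivrMr// ler_pdivlMr//;
    by rewrite mulrC.
rewrite !lebesgue_measure_itv/= !lte_fin ltr_pM2r ?invr_gt0//.
case: ifP => _; last by rewrite mule0.
by rewrite -!EFinD -EFinM -mulrBl mulrC divfK// gt_eqF.
Qed.

Lemma ge0_integral_scale (a : R) (f : R -> \bar R) : (0 < a)%R ->
  measurable_fun [set: R] f -> (forall x, 0 <= f x) ->
  a%:E * \int[lambda]_x f (a * x)%R = \int[lambda]_x f x.
Proof.
move=> a0 mf f0.
have ms : measurable_fun setT
    (fun x : measurableTypeR R => (a * x)%R : measurableTypeR R).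
  exact: measurable_funM.
pose pf : {measure set (measurableTypeR R) -> \bar R} :=
  measure_function_pushforward__canonical__measure_function_Measure lambda ms.
pose mu := mscale (NngNum (ltW a0)) pf.
transitivity (\int[mu]_x f x); last first.
  by apply: eq_measure_integral => A mA _; exact: lebesgue_measure_scale.
rewrite ge0_integral_mscale//; congr (_ * _).
by rewrite [RHS](@ge0_integral_pushforward _ _ _ _ _ _ ms lambda setT f).
Qed.

Lemma ge0_integral_tuple_scale (a : R) n (f : tup n -> \bar R) : (0 < a)%R ->
  measurable_fun [set: tup n] f -> (forall t, 0 <= f t) ->
  (a ^+ n)%:E * \int[lebesgue_tuple R n]_t f (tuple_scale a t) =
  \int[lebesgue_tuple R n]_t f t.
Proof.
move=> a0; elim: n f => [|n IHn] f mf f0.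
  rewrite expr0 mul1e; apply: eq_integral => t _; congr f.
  by apply: eq_from_tnth => -[].
rewrite !ge0_integral_lebesgue_tupleS//; last first.
  exact: measurableT_comp mf (@measurable_tuple_scale a n.+1).
rewrite -[RHS]IHn; last 2 first.
- exact: measurable_integral_tuple_cons.
- by move=> t; exact: integral_ge0.
rewrite exprSr EFinM -muleA; congr (_ * _).
rewrite -ge0_integralZl//; last 3 first.
- apply: (@measurable_integral_tuple_cons R n (f \o @tuple_scale a n.+1)).
    exact: measurableT_comp mf (@measurable_tuple_scale a n.+1).
  by move=> t; exact: f0.
- by move=> t _; exact: integral_ge0.
- by rewrite lee_fin ltW.
apply: eq_integral => t _.
rewrite -[RHS](ge0_integral_scale a0)//; last first.
  exact: (measurableT_comp mf
    (measurable_cons (@measurable_id _ _ _) (measurable_cst _))).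
by congr (_ * _); apply: eq_integral => x _; rewrite tuple_scale_cons.
Qed.

Lemma lebesgue_tuple_scale (a : R) n (A : set (tup n)) :
  (0 < a)%R -> measurable A ->
  (a ^+ n)%:E * lebesgue_tuple R n [set t | A (tuple_scale a t)] =
  lebesgue_tuple R n A.
Proof.
move=> a0 mA.
rewrite -[X in _ = lebesgue_tuple R n X]setIT -integral_indic//.
rewrite -(ge0_integral_tuple_scale a0)//; last first.
  exact/measurable_EFinP/measurable_indic.
congr (_ * _).
rewrite -[X in lebesgue_tuple R n X]setIT -integral_indic//.
rewrite -[X in measurable X]setTI.
exact: measurable_tuple_scale.
Qed.

Lemma integral_tuple_gauss n :
  \int[lebesgue_tuple R n]_t (expR (- \sum_(i < n) tnth t i ^+ 2))%:E =
  (Num.sqrt pi ^+ n)%:E.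
Proof.
have mf k : measurable_fun [set: tup k]
    (fun t : tup k => (expR (- \sum_(i < k) tnth t i ^+ 2)%R)%:E).
  apply/measurable_EFinP; apply: measurableT_comp => //.
  apply: measurableT_comp => //; apply: measurable_sum => i.
  by apply: measurable_funX; exact: measurable_tnth.
elim: n => [|n IHn].
  transitivity (\int[\d_ ([tuple] : tup 0)]_t
    (expR (- \sum_(i < 0) tnth t i ^+ 2))%:E) => //.
  rewrite integral_dirac//.
    by rewrite diracT mul1e big_ord0 oppr0 expR0 expr0.
  exact: (mf 0%N).
rewrite ge0_integral_lebesgue_tupleS; last 2 first.
- exact: (mf n.+1).
- by move=> t; rewrite lee_fin expR_ge0.
transitivity (\int[lebesgue_tuple R n]_t ((Num.sqrt pi)%:E *
    (expR (- \sum_(i < n) tnth t i ^+ 2))%:E)); last first.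
  rewrite ge0_integralZl ?lee_fin ?sqrtr_ge0//.
    by rewrite IHn -EFinM exprS.
  exact: (mf n).
apply: eq_integral => t _.
rewrite -integralT_gauss -ge0_integralZr//; last 2 first.
- apply/measurable_EFinP; exact: measurable_gauss_fun.
- by move=> x _; rewrite lee_fin gauss_fun_ge0.
apply: eq_integral => x _; rewrite -EFinM -expRD; congr (expR _)%:E.
rewrite big_ord_recl opprD; congr (_ - _)%R.
by apply: eq_bigr => i _; rewrite [tnth _ _]tnthS.
Qed.

End tuple_maps.

(** * The volume of the Euclidean ball *)

Section incomplete_gamma.
Context (R : realType).
Implicit Types (s u : R) (k : nat).

(** The incomplete gamma integral of s^k e^-s over [u, +oo[ is e^-u times this
    polynomial in u; the recursion is integration by parts. *)
Fixpoint gamma_poly k s : R :=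
  if k is j.+1 then s ^+ j.+1 + j.+1%:R * gamma_poly j s else 1.

Lemma gamma_poly0 k : gamma_poly k 0 = k`!%:R.
Proof.
by elim: k => [|k IHk] /=; rewrite ?fact0// expr0n add0r IHk factS natrM.
Qed.

Lemma is_derive_gamma_poly k s :
  is_derive s 1 (gamma_poly k) (gamma_poly k s - s ^+ k).
Proof.
elim: k => [|k IHk].
  by rewrite expr0 subrr; exact: is_derive_cst.
have -> : gamma_poly k.+1 =
  (fun s => s ^+ k.+1 + k.+1%:R *: gamma_poly k s) by [].
have dX : is_derive s 1 (fun s : R => s ^+ k.+1) (k.+1%:R * s ^+ k).
  by apply: DeriveDef; [exact: exprn_derivable|rewrite exp_derive [LHS]mulr1].
have H := is_deriveD dX (is_deriveZ k.+1%:R IHk).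
apply: (is_derive_eq H).
rewrite /= /GRing.scale /=; ring.
Qed.

(** The exponential series gives e^s >= s^(k+1) / (k+1)!, so the function is at
    most (k+1)! / s. *)
Lemma cvg_expRN_exprn k : expR (- s) * s ^+ k @[s --> +oo] --> (0 : R).
Proof.
apply: (@squeeze_cvgr _ _ _ _ (fun=> 0) (fun s => k.+1`!%:R * s^-1)).
- near=> s; have s0 : 0 < s by near: s; exact: nbhs_pinfty_gt.
  rewrite mulr_ge0 ?expR_ge0 ?exprn_ge0 ?(ltW s0)//=.
  rewrite expRN mulrC ler_pdivrMr ?expR_gt0//.
  have := expR_ge1Dxn k (ltW s0); set e := expR s => H.
  have : s ^+ k.+1 / k.+1`!%:R <= e by rewrite (le_trans _ H)// lerDr.
  rewrite ler_pdivrMr ?ltr0n ?fact_gt0// exprS => H'.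
  by rewrite -mulrA mulrCA ler_pdivlMl// [leRHS]mulrC.
- exact: cvg_cst.
- rewrite -[X in _ --> X](mulr0 (k.+1`!%:R)); apply: cvgMr.
  apply/gtr0_cvgV0; last exact: cvg_id.
  exact: nbhs_pinfty_gt.
Unshelve. all: by end_near. Qed.

Lemma cvg_expRN_gamma_poly k :
  expR (- s) * gamma_poly k s @[s --> +oo] --> (0 : R).
Proof.
elim: k => [|k IHk].
  by under eq_fun do rewrite /= mulr1; exact: cvgr_expR.
rewrite (_ : (fun s => _) = fun s => expR (- s) * s ^+ k.+1 +
    k.+1%:R * (expR (- s) * gamma_poly k s)); last first.
  by apply/funext => s /=; ring.
rewrite -[X in _ --> X](addr0 0); apply: cvgD; first exact: cvg_expRN_exprn.
by rewrite -[X in _ --> X](mulr0 (k.+1%:R)); apply: cvgMr.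
Qed.

Lemma integral_incomplete_gamma k u : 0 <= u ->
  (\int[lebesgue_measure]_(s in `[u, +oo[) (expR (- s) * s ^+ k)%:E =
   (expR (- u) * gamma_poly k u)%:E)%E.
Proof.
move=> u0; pose F s : R := - (expR (- s) * gamma_poly k s).
have dF s : is_derive s 1 F (expR (- s) * s ^+ k).
  rewrite /F; have := is_derive_gamma_poly k s => dg.
  have de : is_derive s 1 (fun s : R => expR (- s)) (- expR (- s)).
    by apply: is_derive_eq; rewrite mulrN1.
  apply: is_derive_eq; rewrite /GRing.scale/=; ring.
have cF : continuous F.
  move=> s; apply/differentiable_continuous/derivable1_diffP.
  by have [] := dF s.
rewrite (@ge0_continuous_FTC2y _ _ F u 0).
- by rewrite -EFinB sub0r opprK.
- by move=> s us; rewrite mulr_ge0 ?expR_ge0 ?exprn_ge0// (le_trans u0).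
- apply: continuous_subspaceT => s; apply: cvgM; last exact: exprn_continuous.
  apply: (@continuous_comp _ _ _ -%R expR); first exact: opp_continuous.
  exact: continuous_expR.
- by rewrite -oppr0; apply: cvgN; exact: cvg_expRN_gamma_poly.
- by move=> s _; have [] := dF s.
- exact: cvg_at_right_filter (cF u).
- by move=> s _; rewrite derive1E; have [_ ->] := dF s.
Qed.

End incomplete_gamma.

Section ball_volume.
Context (R : realType).
Local Open Scope ereal_scope.
Notation tup n := (n.-tuple (measurableTypeR R)).
Notation lambda := (@lebesgue_measure R).

Definition sum_sqr m (t : tup m) : R := (\sum_(i < m) tnth t i ^+ 2)%R.

Lemma measurable_sum_sqr m : measurable_fun [set: tup m] (@sum_sqr m).
Proof.
apply: measurable_sum => i; apply: measurable_funX; exact: measurable_tnth.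
Qed.

Lemma measurable_sublevel m (s : R) :
  measurable [set t : tup m | (sum_sqr t < s)%R].
Proof.
rewrite -[X in measurable X]setTI.
rewrite (_ : [set t : tup m | _] = @sum_sqr m @^-1` `]-oo, s[).
  exact: measurable_sum_sqr.
by apply/seteqP; split=> t /=; rewrite in_itv.
Qed.

Lemma sum_sqr_scale m (a : R) (t : tup m) :
  sum_sqr (tuple_scale a t) = (a ^+ 2 * sum_sqr t)%R.
Proof.
rewrite /sum_sqr mulr_sumr; apply: eq_bigr => i _.
by rewrite tnth_mktuple exprMn.
Qed.

Lemma sqrtr_expD (x : R) k : (0 <= x)%R -> (Num.sqrt x ^+ (k + k) = x ^+ k)%R.
Proof. by move=> x0; rewrite addnn -mul2n exprM sqr_sqrtr. Qed.

Lemma lebesgue_tuple_sublevel k (s : R) : (0 < s)%R ->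
  lebesgue_tuple R (k + k) [set t | (sum_sqr t < s)%R] =
  (s ^+ k)%:E * lebesgue_tuple R (k + k) [set t | (sum_sqr t < 1)%R].
Proof.
move=> s0; have q0 : (0 < Num.sqrt s)%R by rewrite sqrtr_gt0.
rewrite -[LHS](lebesgue_tuple_scale q0); last exact: measurable_sublevel.
rewrite sqrtr_expD ?(ltW s0)//; congr (_ * lebesgue_tuple R _ _).
apply/seteqP; split=> t /=; rewrite sum_sqr_scale sqr_sqrtr ?(ltW s0)//;
  by rewrite gtr_pMr.
Qed.

(** In R^(2k), write e^(-|t|^2) as the integral of e^-s over s > |t|^2 and
    exchange the order of integration.  On one side this is the Gaussian integral
    pi^k; on the other one the ball of radius sqrt s has volume s^k times that of
    the unit ball, and the remaining integral of s^k e^-s is k!. *)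
Lemma lebesgue_tuple_ball k :
  k`!%:R%:E * lebesgue_tuple R (k + k) [set t | (sum_sqr t < 1)%R] =
  (pi ^+ k)%:E.
Proof.
set m := (k + k)%N; set V := lebesgue_tuple R m _.
pose D : set (measurableTypeR R * tup m) := [set p | (sum_sqr p.2 < p.1)%R].
have mD : measurable D.
  rewrite -[X in measurable X]setTI.
  rewrite (_ : D = (fun p => (p.1 - sum_sqr p.2)%R) @^-1` `]0%R, +oo[).
    apply: (measurable_funB (f := fst)) => //.
    exact: measurableT_comp (@measurable_sum_sqr m) measurable_snd.
  by apply/seteqP; split=> p /=; rewrite in_itv/= andbT subr_gt0.
pose h (p : measurableTypeR R * tup m) : \bar R := (expR (- p.1) * \1_D p)%:E.
have h0 p : 0 <= h p by rewrite lee_fin mulr_ge0 ?expR_ge0.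
have mh : measurable_fun [set: measurableTypeR R * tup m] h.
  apply/measurable_EFinP; apply: measurable_funM; last exact: measurable_indic.
  apply: measurableT_comp => //; exact: measurableT_comp.
have S0 (t : tup m) : (0 <= sum_sqr t)%R.
  by apply: sumr_ge0 => i _; exact: sqr_ge0.
have H := @fubini_tonelli _ _ _ _ R lambda (@sf_lebesgue R m) h mh h0.
have mg j : measurable_fun [set: R] (fun s : R => (expR (- s) * s ^+ j)%:E).
  apply/measurable_EFinP; apply: measurable_funM; last exact: measurable_funX.
  exact: measurableT_comp.
have E1 : \int[lebesgue_tuple R m]_t \int[lambda]_s h (s, t) = (pi ^+ k)%:E.
  transitivity (\int[lebesgue_tuple R m]_t (expR (- sum_sqr t))%:E).
    apply: eq_integral => t _.
    transitivity
      (\int[lambda]_(s in `[sum_sqr t, +oo[) (expR (- s) * s ^+ 0)%:E).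
      rewrite -integral_itv_obnd_cbnd; last exact: measurable_funTS (mg 0%N).
      rewrite [RHS]integral_mkcond; apply: eq_integral => s _.
      have sD : ((s, t) \in D) = (s \in `]sum_sqr t, +oo[%classic).
        by apply/idP/idP; rewrite !inE/= in_itv/= andbT.
      by rewrite /h patchE indicE expr0 sD; case: ifP; rewrite ?mulr0.
    by rewrite integral_incomplete_gamma//= mulr1.
  by rewrite [LHS]integral_tuple_gauss /m sqrtr_expD// pi_ge0.
rewrite -E1 -[RHS]H.
transitivity (\int[lambda]_(s in `]0%R, +oo[) (V * (expR (- s) * s ^+ k)%:E)).
  rewrite ge0_integralZl//.
  - rewrite integral_itv_obnd_cbnd; last exact: measurable_funTS (mg k).
    rewrite integral_incomplete_gamma// oppr0 expR0 mul1r gamma_poly0.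
    by rewrite muleC.
  - exact: measurable_funTS (mg k).
  - move=> s /=; rewrite in_itv/= andbT => s0.
    by rewrite lee_fin mulr_ge0 ?expR_ge0// exprn_ge0// ltW.
  - exact: measure_ge0.
rewrite [LHS]integral_mkcond; apply: eq_integral => s _.
have -> : \int[sf_lebesgue (n:=m)]_y h (s, y) =
    (expR (- s))%:E * lebesgue_tuple R m [set t | (sum_sqr t < s)%R].
  rewrite -[X in lebesgue_tuple R m X]setIT -integral_indic; last 2 first.
  - by [].
  - exact: measurable_sublevel.
  rewrite -ge0_integralZl ?lee_fin ?expR_ge0//.
  by apply/measurable_EFinP/measurable_indic; exact: measurable_sublevel.
rewrite patchE; case: ifPn.
  rewrite inE/= in_itv/= andbT => s0.
  by rewrite lebesgue_tuple_sublevel// muleA -EFinM muleC.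
rewrite notin_setE/= in_itv/= andbT => /negP; rewrite -leNgt => s0.
rewrite (_ : [set t : tup m | _] = set0) ?measure0 ?mule0//.
apply/seteqP; split=> t //=; apply/negP; rewrite -leNgt.
exact: le_trans s0 (S0 t).
Qed.

End ball_volume.

(** * Volumes of sets of row vectors *)

Section volume_theory.
Context (R : realType).
Notation tup n := (n.-tuple (measurableTypeR R)).

Lemma volume_euclidean_ball k :
  (k`!%:R%:E * volume (@euclidean_ball R (k + k)) = (pi ^+ k)%:E)%E.
Proof.
rewrite -lebesgue_tuple_ball; congr (_ * lebesgue_tuple R _ _)%E.
apply/funext => t; rewrite /euclidean_ball /sum_sqr /=.
by congr (is_true (_ < 1)); apply: eq_bigr => i _; rewrite mxE.
Qed.

(** The sets that [lebesgue_tuple] measures come from the product sigma-algebra;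
    an open set is a countable union of cubes with rational centre, which are
    finite intersections of preimages under the coordinates. *)
Lemma open_measurable_row n (A : set 'rV[R]_n) : open A ->
  measurable [set t : tup n | A (\row_i tnth t i)].
Proof.
move=> oA.
pose c (qk : 'rV[rat]_n * nat) : 'rV[R]_n := map_mx (ratr : rat -> R) qk.1.
pose B (qk : 'rV[rat]_n * nat) : set (tup n) :=
  [set t | ball (c qk) qk.2.+1%:R^-1 `<=` A /\
           forall i, ball (c qk 0 i) qk.2.+1%:R^-1 (tnth t i : R)].
have -> : [set t : tup n | A (\row_i tnth t i)] = \bigcup_qk B qk.
  apply/seteqP; split=> [t /= At|t [qk _]]; last first.
    move=> [bA tb]; apply: bA; split=> // i j.
    by rewrite (ord1 i) [X in ball _ _ X]mxE; exact: tb.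
  have /nbhs_ballP[e /= e0 eA] : nbhs (\row_i tnth t i : 'rV[R]_n) A.
    exact: open_nbhs_nbhs.
  have [k] : exists k, k.+1%:R^-1 < e / 2.
    have e20 : 0 < e / 2 by rewrite divr_gt0.
    have [k _ ke] := near_infty_natSinv_lt (PosNum e20).
    by exists k; exact: (ke k (leqnn k)).
  move=> ke; have k0 : 0 < k.+1%:R^-1 :> R by rewrite invr_gt0.
  have qP i : exists q : rat, `|ratr q - tnth t i| < k.+1%:R^-1.
    have /rat_in_itvoo[q] : (tnth t i : R) - k.+1%:R^-1 < tnth t i.
      by rewrite ltrBlDr ltrDl.
    rewrite in_itv /= => /andP[q1 q2]; exists q.
    by rewrite distrC gtr0_norm ?subr_gt0 // ltrBlDr -ltrBlDl.
  exists (\row_i xchoose (qP i), k) => //; rewrite /B /c /=.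
  have tc i : ball (map_mx (ratr : rat -> R) (\row_i xchoose (qP i)) 0 i)
      k.+1%:R^-1 (tnth t i : R).
    rewrite !mxE /ball /=; exact: (xchooseP (qP i)).
  split=> // y yq; apply: eA => /=.
  apply: (@le_ball _ _ _ (k.+1%:R^-1 + k.+1%:R^-1)).
    by rewrite [e in leRHS]splitr lerD // ltW.
  apply: ball_triangle yq; apply: ball_sym.
  by split=> // i j; rewrite (ord1 i) [X in ball _ _ X]mxE; exact: tc.
apply: countable_bigcupT_measurable; first exact: countableP.
move=> qk.
have [bA|bA] := pselect (ball (c qk) qk.2.+1%:R^-1 `<=` A); last first.
  by rewrite (_ : B qk = set0)//; apply/seteqP; split=> t // [].
have -> : B qk =
    \bigcap_(i in [set: 'I_n])
      ((fun t : tup n => tnth t i) @^-1` ball (c qk 0 i : R) qk.2.+1%:R^-1).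
  by apply/seteqP; split=> [t [_ h] i _|t h]; [exact: h|split=> // i; exact: h].
apply: fin_bigcap_measurable => // i _.
rewrite -[X in measurable X]setTI; apply: measurable_tnth => //.
exact: measurable_ball.
Qed.

Lemma closed_measurable_row n (A : set 'rV[R]_n) : closed A ->
  measurable [set t : tup n | A (\row_i tnth t i)].
Proof.
move=> cA; rewrite -[X in measurable X]setCK; apply: measurableC.
by apply: (@open_measurable_row _ (~` A)); exact: closed_openC.
Qed.

Lemma le_volume n (A B : set 'rV[R]_n) : closed A -> closed B -> A `<=` B ->
  (volume A <= volume B)%E.
Proof.
move=> cA cB AB; apply: le_measure; rewrite ?inE.
- exact: closed_measurable_row.
- exact: closed_measurable_row.
- by move=> t; exact: AB.
Qed.

Lemma volume_ge0 n (A : set 'rV[R]_n) : (0 <= volume A)%E.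
Proof. exact: measure_ge0. Qed.

Lemma volume_scale n (r : R) (A : set 'rV[R]_n) : 0 < r -> closed A ->
  (volume [set y | A (r^-1 *: y)] = (r ^+ n)%:E * volume A)%E.
Proof.
move=> r0 cA.
have mA : measurable [set t : tup n | A (r^-1 *: \row_i tnth t i)].
  apply: (@closed_measurable_row _ [set y | A (r^-1 *: y)]).
  apply: closed_comp cA => y _; exact: scaler_continuous.
rewrite /volume -[LHS](lebesgue_tuple_scale r0)//.
congr (_ * lebesgue_tuple R _ _)%E.
rewrite /=; congr (fun P : set (tup n) => P); apply/funext => t /=; congr A.
by apply/rowP => i; rewrite !mxE tnth_mktuple mulrA mulVf ?mul1r// gt_eqF.
Qed.

Lemma volume_lagrangian_product n (K L : set 'rV[R]_n) : closed K -> closed L ->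
  (volume (lagrangian_product K L) = volume K * volume L)%E.
Proof.
move=> cK cL; rewrite /volume -lebesgue_tuple_product;
  [|exact: closed_measurable_row..].
congr (lebesgue_tuple R _ _); apply/funext => t /=.
by congr (K _ /\ L _); apply/rowP => i; rewrite !mxE tnth_mktuple.
Qed.

End volume_theory.

(** * Polar bodies *)

Section dot_product.
Context (R : realType) (n : nat).
Implicit Types (x y z : 'rV[R]_n) (a : R).

(** The pairing in the definition of [polar]; the row y is the linear form. *)
Definition dot y x : R := \sum_i y 0 i * x 0 i.

Lemma dotC y x : dot y x = dot x y.
Proof. by apply: eq_bigr => i _; rewrite mulrC. Qed.

Lemma dotZl a y x : dot (a *: y) x = a * dot y x.
Proof. by rewrite mulr_sumr; apply: eq_bigr => i _; rewrite !mxE mulrA. Qed.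

Lemma dotZr a y x : dot y (a *: x) = a * dot y x.
Proof. by rewrite dotC dotZl dotC. Qed.

Lemma dotNl y x : dot (- y) x = - dot y x.
Proof. by rewrite -scaleN1r dotZl mulN1r. Qed.

Lemma dotNr y x : dot y (- x) = - dot y x.
Proof. by rewrite dotC dotNl dotC. Qed.

Lemma dotDl y z x : dot (y + z) x = dot y x + dot z x.
Proof. by rewrite -big_split; apply: eq_bigr => i _; rewrite !mxE mulrDl. Qed.

Lemma dotDr x y z : dot x (y + z) = dot x y + dot x z.
Proof. by rewrite dotC dotDl !(dotC x). Qed.

Lemma dotBl y z x : dot (y - z) x = dot y x - dot z x.
Proof. by rewrite dotDl dotNl. Qed.

Lemma dotBr x y z : dot x (y - z) = dot x y - dot x z.
Proof. by rewrite dotDr dotNr. Qed.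

Lemma dot_subZ x y (t : R) :
  dot (x - t *: y) (x - t *: y) = dot x x + t * (t * dot y y - 2 * dot y x).
Proof. by rewrite dotBl !dotBr !dotZl !dotZr (dotC x y); ring. Qed.

Lemma dot_delta y i : dot y (delta_mx 0 i) = y 0 i.
Proof.
rewrite /dot (bigD1 i)//= big1 => [|j ji];
  rewrite !mxE eqxx ?eqxx ?mulr1 ?addr0//.
by rewrite (negbTE ji) mulr0.
Qed.

Lemma dot_ge0 x : 0 <= dot x x.
Proof. by apply: sumr_ge0 => i _; rewrite -expr2 sqr_ge0. Qed.

Lemma dot_gt0 x : x != 0 -> 0 < dot x x.
Proof.
move=> x0; rewrite lt_neqAle dot_ge0 andbT eq_sym.
apply: contraNneq x0 => /eqP.
rewrite psumr_eq0; last by move=> i _; rewrite -expr2 sqr_ge0.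
move=> /allP h; apply/eqP/rowP => i; rewrite mxE; apply/eqP.
by have := h i (mem_index_enum i); rewrite /= mulf_eq0 orbb.
Qed.

Lemma continuous_sum_fun (T : topologicalType) m (f : 'I_m -> T -> R) :
  (forall i, continuous (f i)) -> continuous (fun t => \sum_i f i t).
Proof.
move=> cf t; apply: cvg_big => [|i _]; first exact: add_continuous.
exact: cf.
Qed.

Lemma continuous_dot (T : topologicalType) (f g : T -> 'rV[R]_n) :
  continuous f -> continuous g -> continuous (fun t => dot (f t) (g t)).
Proof.
move=> cf cg; apply: continuous_sum_fun => i t.
have cc (y : 'rV[R]_n) : {for y, continuous (fun y : 'rV[R]_n => y 0 i)}.
  exact: coord_continuous.
apply: cvgM; first exact: (continuous_comp (cf t) (cc (f t))).
exact: (continuous_comp (cg t) (cc (g t))).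
Qed.

Lemma closed_polar (K : set 'rV[R]_n) : closed (polar K).
Proof.
have -> : polar K =
    \bigcap_(x in K) ((fun y => dot y x) @^-1` [set a | a <= 1]).
  by apply/seteqP; split=> y h x Kx; exact: h.
apply: closed_bigI => x _; apply: closed_comp; last exact: closed_le.
move=> y _; apply: continuous_dot; last exact: cst_continuous.
by move=> z; exact: cvg_id.
Qed.

End dot_product.

Section bipolar.
Context (R : realType) (n : nat).
Implicit Types (x y z : 'rV[R]_n).

Lemma convex_set_comb (L : set 'rV[R]_n) x y (t : R) :
  convex_set (L : set (convex_lmodType 'rV[R]_n)) ->
  L x -> L y -> 0 <= t <= 1 ->
  L (t *: x + (1 - t) *: y).
Proof.
move=> cL Lx Ly /andP[t0 t1].
by have := cL x y (Itv01 t0 t1) (mem_set Lx) (mem_set Ly) => /set_mem.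
Qed.

(** If some z in L had larger pairing with y - p than p has, then moving p
    slightly towards z would bring it closer to y. *)
Lemma nearest_point_separates (L : set 'rV[R]_n) y p :
  convex_set (L : set (convex_lmodType 'rV[R]_n)) -> L p ->
  (forall z, L z -> dot (y - p) (y - p) <= dot (y - z) (y - z)) ->
  forall z, L z -> dot z (y - p) <= dot p (y - p).
Proof.
move=> cL Lp minp z Lz; rewrite leNgt; apply/negP => lt_pz.
set w := y - p; pose a := dot (z - p) w; pose b := dot (z - p) (z - p).
have a0 : 0 < a by rewrite /a dotBl subr_gt0.
have b0 : 0 <= b by exact: dot_ge0.
have ab0 : 0 < a + b by rewrite ltr_wpDr.
(* Any t with 0 < t <= 1 and t * b < 2 * a would do. *)
pose t := a / (a + b).
have t0 : 0 < t by rewrite divr_gt0.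
have t1 : t <= 1 by rewrite ler_pdivrMr// mul1r lerDl.
have := minp _ (convex_set_comb cL Lz Lp _ : L (t *: z + (1 - t) *: p)).
rewrite (ltW t0) t1 => /(_ isT).
have -> : y - (t *: z + (1 - t) *: p) = w - t *: (z - p).
  by rewrite scalerBl scalerBr scale1r /w; apply/rowP => i; rewrite !mxE; ring.
rewrite dot_subZ -/a -/b lerDl.
rewrite pmulr_rge0// subr_ge0; apply/negP; rewrite -ltNge.
rewrite /t mulrAC ltr_pdivrMr//.
have := mulr_gt0 a0 a0; have := mulr_ge0 (ltW a0) b0.
set ab := a * b; set aa := a * a.
rewrite -mulrA mulrDr -/aa -/ab; lra.
Qed.

(** The nontrivial half of the bipolar theorem: a point y outside L is strictly
    separated from L by a hyperplane orthogonal to y - p, where p is the point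
    of L nearest to y.  Rescaled, its normal vector is in the polar of L and has
    pairing larger than 1 with y. *)
Lemma bipolar_sub (L : set 'rV[R]_n) y :
  compact L -> convex_set (L : set (convex_lmodType 'rV[R]_n)) -> L 0 ->
  (forall x, polar L x -> dot y x <= 1) -> L y.
Proof.
move=> cptL cL L0 yL; apply: contrapT => nLy.
have [p Lp minp] : exists2 p, L p & forall z, L z ->
    dot (y - p) (y - p) <= dot (y - z) (y - z).
  have [||p /set_mem Lp h] :=
    @compact_EVT_min _ R (fun z => dot (y - z) (y - z)) L _ cptL.
  - by exists 0.
  - have cy : continuous (fun z : 'rV[R]_n => y - z).
      by move=> z; exact: (cvgB (cvg_cst y) (@cvg_id _ (nbhs z))).
    exact/continuous_subspaceT/continuous_dot.
  by exists p => // z Lz; exact: h (mem_set Lz).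
have sep := nearest_point_separates cL Lp minp.
set w := y - p in sep.
have w0 : w != 0.
  by apply: contra_notN nLy => /eqP/subr0_eq ->.
have ww := dot_gt0 w0.
pose h := dot p w; have h0 : 0 <= h.
  by rewrite -[leLHS](_ : dot 0 w = 0) ?sep// -[0](scale0r 0) dotZl mul0r.
have yw : dot y w = h + dot w w by rewrite -dotDl addrC subrK.
(* The level of the hyperplane halfway between p and y; h itself may be 0. *)
pose c := h + dot w w / 2.
have c0 : 0 < c by rewrite ltr_wpDl// divr_gt0.
have : polar L (c^-1 *: w).
  move=> z Lz; rewrite -/(dot _ z) dotZl dotC ler_pdivrMl// mulr1.
  by rewrite (le_trans (sep _ Lz))// /c lerDl divr_ge0// ltW.
move=> /yL; apply/negP; rewrite -ltNge dotZr yw ltr_pdivlMl// mulr1 /c ltrD2l.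
by rewrite ltr_pdivrMr// ltr_pMr// ltr1n.
Qed.

End bipolar.

Section symmetric_bodies.
Context (R : realType) (n : nat).
Implicit Types (K L : set 'rV[R]_n) (x y z : 'rV[R]_n).

Lemma symmetricN K z : centrally_symmetric K -> K z -> K (- z).
Proof. by move=> sK Kz; rewrite -sK; exists z. Qed.

(** If the ball around x is in K, so is its mirror image around - x, and the
    ball around 0 consists of midpoints of points of the two. *)
Lemma convex_body_ball K : convex_body K -> centrally_symmetric K ->
  exists2 e : R, 0 < e & ball (0 : 'rV[R]_n) e `<=` K.
Proof.
move=> [_ cK [x Kx]] sK.
have /nbhs_ballP[e /= e0 eK] : nbhs x K by [].
exists e => // z; rewrite -ball_normE /= sub0r normrN => ze.
have K1 : K (x + z).
  by apply: eK; rewrite -ball_normE /= opprD addrA subrr sub0r normrN.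
have K2 : K (z - x).
  rewrite -[z - x]opprB; apply: symmetricN => //; apply: eK.
  by rewrite -ball_normE /= opprB addrC subrK.
have -> : z = 2^-1 *: (x + z) + (1 - 2^-1) *: (z - x).
  apply/rowP => i; rewrite !mxE; by field.
by apply: convex_set_comb => //; lra.
Qed.

Lemma convex_body0 K : convex_body K -> centrally_symmetric K -> K 0.
Proof.
by move=> bK sK; have [e e0 eK] := convex_body_ball bK sK; apply/eK/ballxx.
Qed.

Lemma compact_polar K : convex_body K -> centrally_symmetric K ->
  compact (polar K).
Proof.
move=> bK sK; have [e e0 eK] := convex_body_ball bK sK.
apply: bounded_closed_compact; last exact: closed_polar.
exists (2 / e); split; first exact: num_real.
move=> M eM y Ky; rewrite /= [leLHS]/Num.Def.normr/= mx_normrE.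
apply: bigmax_le => [|[i j] _].
  by rewrite ltW// (lt_trans _ eM)// divr_gt0.
rewrite (ord1 i) /= (le_trans _ (ltW eM))//.
have Kj (s : R) : `|s| = 1 -> s * y 0 j <= 2 / e.
  move=> s1; have : K ((e / 2 * s) *: delta_mx 0 j).
    apply: eK; rewrite -ball_normE /= sub0r normrN normrZ normrM s1 mulr1.
    rewrite gtr0_norm ?divr_gt0//.
    have d1 : `|delta_mx 0 j : 'rV[R]_n| <= 1.
      rewrite [leLHS]/Num.Def.normr/= mx_normrE.
      apply: bigmax_le => // -[k l] _.
      by rewrite /= mxE; case: (_ && _); rewrite ?normr1 ?normr0.
    rewrite (@le_lt_trans _ _ (e / 2))//.
      by rewrite ler_piMr// ltW// divr_gt0.
    by rewrite ltr_pdivrMr// ltr_pMr// ltr1n.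
  move=> /Ky; rewrite -/(dot _ _) dotZr dot_delta -mulrA.
  by rewrite -ler_pdivlMl ?divr_gt0// mulr1 invf_div.
rewrite ler_norml lerNl; apply/andP; split.
  by have := Kj (-1); rewrite normrN1 mulN1r => /(_ erefl).
by have := Kj 1; rewrite normr1 mul1r => /(_ erefl).
Qed.

Lemma polar_delta K (i : 'I_n) : compact K ->
  exists2 a : R, 0 < a & polar K (a *: delta_mx 0 i).
Proof.
move=> /compact_bounded/ex_strict_bound_gt0[M M0 bM].
exists M^-1; first by rewrite invr_gt0.
move=> z Kz; rewrite -/(dot _ z) dotZl dotC dot_delta ler_pdivrMl// mulr1.
rewrite (le_trans (ler_norm _))// (le_trans _ (ltW (bM _ Kz)))//.
rewrite [leRHS]/Num.Def.normr/= mx_normrE.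
exact: (le_bigmax _ (fun ij : 'I_1 * 'I_n => `|z ij.1 ij.2|) (0, i)).
Qed.

Lemma polar_bound K q : centrally_symmetric K -> polar K q ->
  forall z, K z -> `|dot q z| <= 1.
Proof.
move=> sK Kq z Kz; rewrite ler_norml lerNl -dotNr; apply/andP; split.
  exact: Kq (symmetricN sK Kz).
exact: Kq.
Qed.

(** The pair maximizes the pairing over the product of the polars; the last
    clause is the bipolar theorem applied to the maximality of the pair. *)
Lemma extremal_polar_pair K L : (0 < n)%N ->
  convex_body K -> centrally_symmetric K ->
  convex_body L -> centrally_symmetric L ->
  exists q x : 'rV[R]_n, [/\ polar K q, polar L x, 0 < dot q x &
    forall y, polar K (dot q x *: y) -> L y].
Proof.
move=> n0 bK sK bL sL; pose i0 := Ordinal n0.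
have [a a0 aK] := polar_delta i0 (let: And3 c _ _ := bK in c).
have [b b0 bLb] := polar_delta i0 (let: And3 c _ _ := bL in c).
have cKL : compact (polar K `*` polar L).
  by apply: compact_setX; exact: compact_polar.
have [||[q x] /set_mem [/= Kq Lx] maxqx] :=
    @compact_EVT_max _ R (fun p => dot p.1 p.2) (polar K `*` polar L) _ cKL.
- by exists (a *: delta_mx 0 i0, b *: delta_mx 0 i0).
- apply: continuous_subspaceT; apply: continuous_dot => p;
    [exact: cvg_fst|exact: cvg_snd].
have qx0 : 0 < dot q x.
  have := maxqx (a *: delta_mx 0 i0, b *: delta_mx 0 i0)
    (mem_set (conj aK bLb)).
  apply: lt_le_trans; rewrite /= dotZl dotZr dot_delta mxE !eqxx mulr1.
  exact: mulr_gt0.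
exists q, x; split=> // y Ky.
have [cL vL _] := bL.
apply: bipolar_sub => //; first exact: convex_body0.
move=> x' Lx'; have := maxqx (dot q x *: y, x') (mem_set (conj Ky Lx')).
by rewrite /= dotZl ger_pMr.
Qed.

End symmetric_bodies.

(** * The inequality for Lagrangian products *)

Theorem proposition1p5 (R : realType) (n : nat) (K L : set 'rV[R]_n)
    (n_gt0 : (0 < n)%N)
    (convexK : convex_body K) (symK : centrally_symmetric K)
    (convexL : convex_body L) (symL : centrally_symmetric L)
    (mahlerK : ((4 ^+ n / n`!%:R)%:E <= volume K * volume (polar K))%E)
    (c : symplectic_capacity R n) :
  (capacity c (lagrangian_product K L) / capacity c (@euclidean_ball R (n + n))
    <= (volume (lagrangian_product K L) / volume (@euclidean_ball R (n + n)))
       `^ n%:R^-1)%E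
  /\
  (capacity c (lagrangian_product K L) ^+ n
    <= n`!%:R%:E * volume (lagrangian_product K L))%E.
Proof.
have [q [x [Kq Lx M0 polarKL]]] :=
  extremal_polar_pair n_gt0 convexK symK convexL symL.
set M := dot q x in M0 polarKL.
have cle : (capacity c (lagrangian_product K L) <= (4 / M)%:E)%E.
  case: n n_gt0 => // n' _ in K L convexK symK convexL symL mahlerK c q x Kq
    Lx M M0 polarKL *.
  apply: (@capacity_between_hyperplanes R n' c _ q x M) => // z [Kz Lz].
    exact: polar_bound Kz.
  exact: polar_bound Lz.
have [cptK _ _] := convexK; have [cptL _ _] := convexL.
have closedK : closed K by apply: compact_closed cptK; exact: norm_hausdorff.
have closedL : closed L by apply: compact_closed cptL; exact: norm_hausdorff.
have volL : ((M^-1 ^+ n)%:E * volume (polar K) <= volume L)%E.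
  rewrite -volume_scale ?invr_gt0//; last exact: closed_polar.
  apply: le_volume => //; last by move=> y; rewrite /= invrK; exact: polarKL.
  apply: (closed_comp _ (@closed_polar R n K)) => y _; exact: scaler_continuous.
have fact0 : 0 < n`!%:R :> R by rewrite ltr0n fact_gt0.
have volKL : (((4 / M) ^+ n)%:E <=
    n`!%:R%:E * volume (lagrangian_product K L))%E.
  rewrite volume_lagrangian_product//.
  apply: (@le_trans _ _ (n`!%:R%:E *
    (volume K * ((M^-1 ^+ n)%:E * volume (polar K))))%E).
    rewrite muleCA [X in (volume K * X)%E]muleA -EFinM muleCA.
    apply: (@le_trans _ _ ((n`!%:R * M^-1 ^+ n)%:E * (4 ^+ n / n`!%:R)%:E)%E).
      rewrite -EFinM lee_fin exprMn [leRHS]mulrAC mulrCA mulrA.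
      by rewrite mulfK ?gt_eqF.
    rewrite lee_pmul2l// lte_fin mulr_gt0// exprn_gt0// invr_gt0//.
  rewrite lee_pmul2l// lee_pmul// ?volume_ge0// mule_ge0// ?volume_ge0//.
  by rewrite lee_fin exprn_ge0// invr_ge0 ltW.
have c0 : (0 <= capacity c (lagrangian_product K L))%E by exact: capacity_ge0.
have [k kE k0] : exists2 k : R,
    capacity c (lagrangian_product K L) = k%:E & 0 <= k.
  move: c0 cle; case: (capacity c _) => [k k0 _|_|]//; by exists k.
have volcap : ((k ^+ n)%:E <= n`!%:R%:E * volume (lagrangian_product K L))%E.
  apply: le_trans volKL; rewrite lee_fin lerXn2r ?nnegrE//.
    by rewrite ltW// divr_gt0.
  by rewrite -lee_fin -kE.
split; last by rewrite kE -EFin_expe.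
have p0 : 0 < pi :> R by exact: pi_gt0.
have volB : volume (@euclidean_ball R (n + n)) = (pi ^+ n / n`!%:R)%:E.
  have := volume_euclidean_ball R n.
  case: (volume _) (volume_ge0 (@euclidean_ball R (n + n))) => [v _|_|]//.
    move=> [E]; congr _%:E; by rewrite -E mulrAC mulfV ?mul1r// gt_eqF.
  by rewrite mulry gtr0_sg// mul1e.
rewrite kE volB; rewrite (_ : capacity c _ = pi%:E); last exact: capacity_ball.
have v0 : 0 < pi ^+ n / n`!%:R :> R by rewrite divr_gt0// exprn_gt0.
rewrite !inver (gt_eqF p0) (gt_eqF v0) -EFinM invf_div.
have -> : (k / pi)%:E = (((k / pi) ^+ n)%:E `^ n%:R^-1)%E.
  rewrite poweR_EFin -powR_mulrn ?divr_ge0 ?(ltW p0)// -powRrM mulfV ?powRr1//.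
    by rewrite divr_ge0 ?(ltW p0).
  by rewrite pnatr_eq0 -lt0n.
have ge0_itv (y : \bar R) : (0 <= y)%E -> y \in `[0%E, +oo%E].
  by move=> y0; rewrite in_itv/= y0 leey.
have kpi0 : 0 <= (k / pi) ^+ n by rewrite exprn_ge0// divr_ge0// ltW.
apply: gt0_ler_poweR; rewrite ?invr_ge0 ?ler0n ?ge0_itv ?lee_fin//.
  by rewrite mule_ge0 ?volume_ge0// lee_fin divr_ge0// ltW// exprn_gt0.
rewrite expr_div_n.
have -> : (k ^+ n / pi ^+ n)%:E = ((k ^+ n)%:E * (pi ^+ n)^-1%:E)%E.
  by rewrite EFinM.
rewrite (EFinM n`!%:R) muleA lee_pmul2r ?lte_fin ?invr_gt0 ?exprn_gt0//.
by rewrite muleC.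
Qed.
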